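(* For every positive integer $k$, there exists an extremal Type~II $\mathbb{Z}_{2k}$-code of length $56$.
   Context: $\mathbb{Z}_m$ denotes the ring of integers modulo $m$. A $\mathbb{Z}_m$-code of length $n$ is a $\mathbb{Z}_m$-submodule of $\mathbb{Z}_m^n$; it is self-dual if $C=C^\perp$ with respect to the standard inner product. The Euclidean weight of $x=(x_1,\dots,x_n)\in\mathbb{Z}_m^n$ is $\sum_{\alpha=1}^{\lfloor m/2\rfloor} n_\alpha(x)\alpha^2$, where $n_\alpha(x)$ is the number of $i$ with $x_i\equiv\pm\alpha \pmod m$; $d_E(C)$ is the minimum Euclidean weight of a nonzero codeword. A Type~II $\mathbb{Z}_{2k}$-code is a self-dual $\mathbb{Z}_{2k}$-code all of whose codewords have Euclidean weight divisible by $4k$. For a Type~II $\mathbb{Z}_{2k}$-code $C$ of length $n\le 136$ one has $d_E(C)\le 4k\lfloor n/24\rfloor+4k$, and $C$ is called extremal if equality holds. *)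

(* Defs.v *)
From mathcomp Require Import all_boot all_order all_algebra.
Set Implicit Arguments. Unset Strict Implicit. Unset Printing Implicit Defensive.
Import GRing.Theory.
Local Open Scope ring_scope.

(* Vectors of Z_m^n are row vectors 'rV['Z_m]_n; we only use m >= 2. *)

Definition is_code (m n : nat) (C : {set 'rV['Z_m]_n}) : Prop :=
  [/\ (0 : 'rV['Z_m]_n) \in C,
      (forall x y, x \in C -> y \in C -> x + y \in C) &
      (forall (a : 'Z_m) x, x \in C -> a *: x \in C)].

Definition inner (m n : nat) (x y : 'rV['Z_m]_n) : 'Z_m :=
  \sum_(i < n) x ord0 i * y ord0 i.

Definition dual (m n : nat) (C : {set 'rV['Z_m]_n}) : {set 'rV['Z_m]_n} :=
  [set x | [forall y in C, inner x y == 0]].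

Definition self_dual (m n : nat) (C : {set 'rV['Z_m]_n}) : Prop :=
  C = dual C.

(* Euclidean weight: a coordinate with residue a in [0, m) is +-alpha
   with alpha = min(a, m - a) in [0, floor(m/2)], contributing alpha^2. *)
Definition euclid_weight (m n : nat) (x : 'rV['Z_m]_n) : nat :=
  (\sum_(i < n) (minn (val (x ord0 i)) (m - val (x ord0 i))) ^ 2)%N.

Definition min_euclid_weight (m n : nat) (C : {set 'rV['Z_m]_n}) (d : nat) : Prop :=
  (exists2 c, c \in C & (c != 0) && (euclid_weight c == d)) /\
  (forall c, c \in C -> c != 0 -> (d <= euclid_weight c)%N).

Definition typeII (k n : nat) (C : {set 'rV['Z_(2 * k)]_n}) : Prop :=
  [/\ is_code C, self_dual C &
      forall c, c \in C -> (4 * k %| euclid_weight c)%N].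

Definition extremal_typeII (k n : nat) (C : {set 'rV['Z_(2 * k)]_n}) : Prop :=
  typeII C /\ min_euclid_weight C (4 * k * (n %/ 24) + 4 * k)%N.

(* Main.v *)
(* For k >= 3 all the codes come from one lattice.  A ternary extremal self-dual code of length 56
   gives by construction A a unimodular lattice, whose even neighbour has minimum norm 6 in dimension
   56.  Every frame of this lattice, that is 56 pairwise orthogonal vectors of norm 2k, turns it into
   an extremal Type II code over Z_2k.  The ternary code has a generator matrix (1, M) mod 3, where M
   is a circulant of quaternions with M M^T = 50.  Since M commutes with left quaternion
   multiplications L, the rows of (L, M; -M^T, L^T) are a frame up to scale as soon as
   |L|^2 + 50 = 6k, and they lie in the lattice when L = 1 mod 3.  By Lagrange's theorem and
   a Hadamard step such an L exists for every k >= 9.  The remaining frames are explicit; the codes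
   for k = 1, 2 are a bordered double circulant code and a Z_4-code found by computer search.

   Minimum weights are established by enumerating sums of few generators.  For the ternary code the
   enumeration uses the symmetry under the quaternion units and the cyclic shift of order 7, whose
   orbits are reduced by the cycle lemma. *)

From Stdlib Require Import ZArith.
Require Import Defs.
From mathcomp Require Import all_boot all_order all_algebra.
From mathcomp Require Import zify ssrZ ring.
Set Implicit Arguments. Unset Strict Implicit. Unset Printing Implicit Defensive.
Import Order.TTheory GRing.Theory Num.Theory.
Delimit Scope Z_scope with coqZ.
Local Open Scope ring_scope.

(** * Sums of four squares *)

(** Relative to a frame of norm 2k, a lattice vector of norm N has integer coordinates whose squares
    sum to 2kN, so minimum norm 6 becomes the weight 12k = 4k * 2 + 4k. Frame vectors are themselves
    lattice vectors, so 2k cannot be below 6; this is why k = 1, 2 need codes of another origin.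
    Since norms in the lattice are even, it is enough to exceed 4. A ternary word of weight w gives
    norm w / 3 at least, so only w > 12 has to be verified. Construction A also contains the vectors
    of norm 3 coming from 3 times a unit vector; the even neighbour drops them, and its new coset
    consists of vectors whose coordinates are all odd multiples of 1 / (2 sqrt 3), with norm at
    least 56 / 12 > 4. This is where dimension 56 matters. The constant 50 plays two parts: 50 = -1
    mod 3 makes the code (1, M) self-dual, and 6k - 50 is the norm left for L, which is positive
    exactly from k = 9 on. *)

Definition sum4 (n : int) : Prop :=
  exists a b c d : int, n = a ^+ 2 + b ^+ 2 + c ^+ 2 + d ^+ 2.

Lemma sum4_mul (m n : int) : sum4 m -> sum4 n -> sum4 (m * n).
Proof.
move=> [a [b [c [d ->]]]] [x [y [z [t ->]]]].
exists (a * x + b * y + c * z + d * t), (a * y - b * x + c * t - d * z),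
  (a * z - c * x + d * y - b * t), (a * t - d * x + b * z - c * y).
by ring.
Qed.

Lemma sqr_injm (p h x y : nat) : prime p -> p = h.*2.+1 -> (x <= h)%N -> (y <= h)%N ->
  (x ^ 2 = y ^ 2 %[mod p])%N -> x = y.
Proof.
wlog xy : x y / (x <= y)%N.
  move=> W pp ph hx hy e; case/orP: (leq_total x y) => l; first exact: W.
  by apply/esym; apply: W => //.
move=> pp ph hx hy /eqP; rewrite eq_sym eqn_mod_dvd ?leq_exp2r // subn_sqr Euclid_dvdM //.
by case/orP=> /dvdnP[[|q] e]; nia.
Qed.

(** Pigeonhole: with p = 2h + 1, the squares of 0..h and the values -(y^2 + 1) give h + 1 distinct
    residues each, so the two families meet. The factor [p.-1] stands for -1 in the natural
    numbers. *)
Lemma sum_sqr1_dvd (p : nat) : prime p -> odd p ->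
  exists x y : nat, [/\ (x.*2 < p)%N, (y.*2 < p)%N & (p %| x ^ 2 + y ^ 2 + 1)%N].
Proof.
move=> pp op; have [h ph] : exists h, p = h.*2.+1 by exists p./2; lia.
have p0 : (0 < p)%N by lia.
pose f (x : 'I_h.+1) : 'I_p := Ordinal (ltn_pmod (x ^ 2) p0).
pose g (x : 'I_h.+1) : 'I_p := Ordinal (ltn_pmod (p.-1 * (x ^ 2 + 1)) p0).
have fI : injective f.
  move=> x y /(congr1 val) /= e; apply: val_inj => /=.
  have hx : (x <= h)%N := ltn_ord x; have hy : (y <= h)%N := ltn_ord y.
  exact: sqr_injm pp ph hx hy e.
have gI : injective g.
  move=> x y /(congr1 val) /= /eqP e; apply: val_inj => /=.
  have hx : (x <= h)%N := ltn_ord x; have hy : (y <= h)%N := ltn_ord y.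
  apply: (sqr_injm pp ph hx hy).
  have R u v : (p.-1 * u + (u + v) = u * p + v)%N.
    by rewrite addnA; congr (_ + _)%N; rewrite -{2}(prednK p0) mulnS mulnC addnC.
  have : ((x ^ 2 + 1) * p + y ^ 2 == (y ^ 2 + 1) * p + x ^ 2 %[mod p])%N.
    rewrite -!R [in X in _ == X %[mod p]]addnAC [(y ^ 2 + x ^ 2)%N]addnC.
    by rewrite [(_ + 1 + y ^ 2)%N]addnAC eqn_modDr.
  by rewrite !modnMDl => /eqP.
have : ~~ [disjoint f @: setT & g @: setT].
  apply/negP => D.
  have := max_card (mem (f @: setT :|: g @: setT)).
  rewrite cardsU disjoint_setI0 // cards0 !card_imset // !cardsT !card_ord; lia.
case/pred0Pn=> z /andP[/imsetP[x _ ->] /imsetP[y _ /(congr1 val) /= e]].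
have := ltn_ord x; have := ltn_ord y => hy hx; exists x, y; split; [lia | lia | ].
have : (x ^ 2 + (y ^ 2 + 1) = p.-1 * (y ^ 2 + 1) + (y ^ 2 + 1) %[mod p])%N.
  by apply/eqP; rewrite eqn_modDr; apply/eqP.
have -> : (p.-1 * (y ^ 2 + 1) + (y ^ 2 + 1) = (y ^ 2 + 1) * p)%N.
  by rewrite -{2}(prednK p0) mulnS mulnC addnC.
by rewrite modnMl addnA => /eqP.
Qed.

Lemma centered_mod (m : int) (x : int) : 0 < m ->
  exists y q : int, [/\ x = y + m * q, - m <= 2 * y & 2 * y <= m].
Proof.
move=> m0; have := divz_eq x m; have := modz_ge0 x (lt0r_neq0 m0); have := ltz_pmod x m0.
set r := (x %% m)%Z; set q := (x %/ m)%Z => h1 h2 e.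
case: (lerP (2 * r) m) => h; first by exists r, q; split; lia.
by exists (r - m), (q + 1); split; lia.
Qed.

Lemma half_sqr (m x : int) : - m <= 2 * x -> 2 * x <= m -> 4 * x ^+ 2 <= m ^+ 2.
Proof.
move=> h1 h2; rewrite -subr_ge0.
have -> : m ^+ 2 - 4 * x ^+ 2 = (m - 2 * x) * (m + 2 * x) by ring.
by apply: mulr_ge0; lia.
Qed.

Lemma sum4_eq0 (a b c d : int) : a ^+ 2 + b ^+ 2 + c ^+ 2 + d ^+ 2 = 0 ->
  [/\ a = 0, b = 0, c = 0 & d = 0].
Proof.
have := sqr_ge0 a; have := sqr_ge0 b; have := sqr_ge0 c; have := sqr_ge0 d.
move=> d0 c0 b0 a0 e.
by split; apply/eqP; rewrite -sqrf_eq0; apply/eqP; lia.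
Qed.

(** Lagrange's descent: Euler's identity for the given entries and their centered remainders mod [m]
    produces four multiples of [m]; their quotients are the witnesses. *)
Lemma sum4_descent (p m : int) : 1 < m -> m < p -> (forall d, 1 < d -> d < p -> ~~ (d %| p)%Z) ->
  sum4 (m * p) -> exists r, [/\ 0 < r, r < m & sum4 (r * p)].
Proof.
move=> m1 mp prp [a [b [c [d e]]]]; have m0 : 0 < m by lia.
have [a' [qa [ea a1 a2]]] := centered_mod a m0.
have [b' [qb [eb b1 b2]]] := centered_mod b m0.
have [c' [qc [ec c1 c2]]] := centered_mod c m0.
have [d' [qd [ed d1 d2]]] := centered_mod d m0.
pose s := a' ^+ 2 + b' ^+ 2 + c' ^+ 2 + d' ^+ 2.
pose r := p - (2 * (a' * qa + b' * qb + c' * qc + d' * qd)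
               + m * (qa ^+ 2 + qb ^+ 2 + qc ^+ 2 + qd ^+ 2)).
have es : s = m * r by rewrite /r mulrBr e /s ea eb ec ed; ring.
have := half_sqr a1 a2; have := half_sqr b1 b2; have := half_sqr c1 c2; have := half_sqr d1 d2.
move=> Qd Qc Qb Qa.
have sm : s <= m ^+ 2 by rewrite /s; clear -Qa Qb Qc Qd; lia.
have s0 : 0 <= s by rewrite /s !addr_ge0 ?sqr_ge0.
have rm : r <= m by rewrite -(ler_pM2l m0) -es -expr2.
have r0 : 0 <= r by rewrite -(pmulr_rge0 _ m0) -es.
(* If [r = 0], all remainders vanish, so m^2 divides m p and [m] divides [p]. *)
have r_neq0 : r != 0.
  apply/eqP => r0'; have s00 : s = 0 by rewrite es r0' mulr0.
  have /negP[] := prp m m1 mp.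
  have [A B C D] := sum4_eq0 s00; apply/dvdzP.
  exists (qa ^+ 2 + qb ^+ 2 + qc ^+ 2 + qd ^+ 2).
  apply: (mulfI (lt0r_neq0 m0)); rewrite e ea eb ec ed A B C D; ring.
(* If [r = m], equality holds in all four bounds, so every remainder is m / 2 up to sign. Then four
   times each square is m^2 (4t + 1), and again m^2 divides m p. *)
have r_neqm : r != m.
  apply/eqP => rm'; have ss : s = m ^+ 2 by rewrite es rm' expr2.
  have /negP[] := prp m m1 mp.
  have H (x : int) : 4 * x ^+ 2 = m ^+ 2 -> (2 * x == m) || (2 * x == - m).
    by move=> hx; rewrite -eqf_sqr -hx exprMn; apply/eqP; ring.
  move: ss; rewrite /s => ss.
  have /H Ha : 4 * a' ^+ 2 = m ^+ 2 by clear -ss Qa Qb Qc Qd; lia.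
  have /H Hb : 4 * b' ^+ 2 = m ^+ 2 by clear -ss Qa Qb Qc Qd; lia.
  have /H Hc : 4 * c' ^+ 2 = m ^+ 2 by clear -ss Qa Qb Qc Qd; lia.
  have /H Hd : 4 * d' ^+ 2 = m ^+ 2 by clear -ss Qa Qb Qc Qd; lia.
  have K (x q : int) : (2 * x == m) || (2 * x == - m) ->
      exists t, 4 * (x + m * q) ^+ 2 = m ^+ 2 * (4 * t + 1).
    have E : 4 * (x + m * q) ^+ 2 = (2 * x + 2 * (m * q)) ^+ 2 by ring.
    by case/orP=> /eqP h; [exists (q ^+ 2 + q) | exists (q ^+ 2 - q)]; rewrite E h; ring.
  have [ta Ta] := K _ qa Ha; have [tb Tb] := K _ qb Hb.
  have [tc Tc] := K _ qc Hc; have [td Td] := K _ qd Hd.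
  apply/dvdzP; exists (ta + tb + tc + td + 1).
  have : 4 * (m * p) = m * (4 * ((ta + tb + tc + td + 1) * m)).
    by rewrite e ea eb ec ed !mulrDr Ta Tb Tc Td; ring.
  rewrite mulrCA => /(mulfI (lt0r_neq0 m0)); exact: mulfI.
exists r; split; [by rewrite lt0r r_neq0 | by rewrite lt_neqAle r_neqm |].
exists (r + (qa * a' + qb * b' + qc * c' + qd * d')), (qa * b' - qb * a' + qc * d' - qd * c'),
  (qa * c' - qc * a' + qd * b' - qb * d'), (qa * d' - qd * a' + qb * c' - qc * b').
apply: (mulfI (lt0r_neq0 m0)); apply: (mulfI (lt0r_neq0 m0)).
have -> : m * (m * (r * p)) = (m * p) * s by rewrite es; ring.
rewrite e; transitivity ((s + m * (qa * a' + qb * b' + qc * c' + qd * d')) ^+ 2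
  + (m * (qa * b' - qb * a' + qc * d' - qd * c')) ^+ 2
  + (m * (qa * c' - qc * a' + qd * b' - qb * d')) ^+ 2
  + (m * (qa * d' - qd * a' + qb * c' - qc * b')) ^+ 2); last by rewrite es; ring.
by rewrite /s ea eb ec ed; ring.
Qed.

Lemma sum4_prime (p : nat) : prime p -> sum4 p.
Proof.
move=> pp; have [->|op] := even_prime pp; first by exists 1, 1, 0, 0.
have p1 := prime_gt1 pp.
have prp (d : int) : 1 < d -> d < Posz p -> ~~ (d %| Posz p)%Z.
  case: d => // d d1 dp; apply/negP; rewrite dvdzE /= => /(prime_nt_dvdP pp); lia.
have [x [y [x2 y2 /dvdnP[m em]]]] := sum_sqr1_dvd pp op.
have em' : (m%:Z * p) = x%:Z ^+ 2 + y%:Z ^+ 2 + 1 ^+ 2 + 0 ^+ 2 by lia.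
have mp : (m < p)%N by nia.
have m0 : (0 < m)%N by lia.
have {em em' x y x2 y2} : sum4 (m%:Z * p) by exists x, y, 1, 0.
elim/ltn_ind: m m0 mp => m IH m0 mp s.
case: (ltngtP m 1%N) => h; [lia| |by rewrite h mul1r in s].
have [||r [r0 rm sr]] := sum4_descent _ _ prp s; [lia|lia|].
case: r r0 rm sr => // r r0 rm sr.
by apply: (IH r) => //; lia.
Qed.

Lemma sum4_nat (n : nat) : sum4 n.
Proof.
elim/ltn_ind: n => n IH.
case: (ltnP n 2) => [|n1].
  by case: n {IH} => [|[|//]] _; [exists 0, 0, 0, 0 | exists 1, 0, 0, 0].
have pp := pdiv_prime n1; have /dvdnP[q e] := pdiv_dvd n.
have p1 := prime_gt1 pp; rewrite {1}e PoszM; apply: sum4_mul; last exact: sum4_prime.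
by apply: IH; nia.
Qed.

Lemma mod2_cases (x : int) : exists q, x = 2 * q \/ x = 2 * q + 1.
Proof.
have := divz_eq x 2; have := @modz_ge0 x 2 isT; have := @ltz_pmod x 2 isT.
by move=> h1 h2 e; exists (x %/ 2)%Z; lia.
Qed.

Lemma mod3_cases (x : int) : exists q, [\/ x = 3 * q, x = 3 * q + 1 | x = 3 * q - 1].
Proof.
have := divz_eq x 3; have := @modz_ge0 x 3 isT; have := @ltz_pmod x 3 isT.
set r := (x %% 3)%Z; set q := (x %/ 3)%Z => h1 h2 e.
have [r0|[r1|r2]] : r = 0 \/ r = 1 \/ r = 2 by lia.
- by exists q; constructor 1; lia.
- by exists q; constructor 2; lia.
- by exists (q + 1); constructor 3; lia.
Qed.

(* The Hadamard step turns a representation all of whose entries are nonzero mod 3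
   into one with exactly one nonzero entry; evenness of [n] keeps it integral. *)
Lemma sum4_mod3 (n : nat) : (n %% 6 = 4)%N ->
  exists z u v w : int, n%:Z = (1 + 3 * z) ^+ 2 + (3 * u) ^+ 2 + (3 * v) ^+ 2 + (3 * w) ^+ 2.
Proof.
move=> n6; have [a [b [c [d e]]]] := sum4_nat n.
have S (x : int) : exists (y q r : int) (i : bool), [/\ x ^+ 2 = y ^+ 2,
    y = i%:R + 3 * q & y ^+ 2 = i%:R + 3 * r].
  have [q [ex|ex|ex]] := mod3_cases x.
  - by exists x, q, (3 * q ^+ 2), false; rewrite ex; split; rewrite /= ?mulr0n ?mulr1n; ring.
  - by exists x, q, (3 * q ^+ 2 + 2 * q), true; rewrite ex; split; rewrite /= ?mulr0n ?mulr1n; ring.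
  - by exists (- x), (- q), (3 * q ^+ 2 - 2 * q), true; rewrite ex; split; rewrite /= ?mulr0n ?mulr1n; ring.
have [A [qa [ra [ia [ea Ha ha]]]]] := S a; have [B [qb [rb [ib [eb Hb hb]]]]] := S b.
have [C [qc [rc [ic [ec Hc hc]]]]] := S c; have [D [qd [rd [id [ed Hd hd]]]]] := S d.
have {S ea eb ec ed}e : n%:Z = A ^+ 2 + B ^+ 2 + C ^+ 2 + D ^+ 2 by rewrite e ea eb ec ed.
(* The number of entries prime to 3 is congruent to n, that is to 1, mod 3. *)
have I : (ia + ib + ic + id == 1)%N || (ia + ib + ic + id == 4)%N.
  by move: e; rewrite ha hb hc hd; clear -n6; lia.
have ev : exists t, A + B + C + D = 2 * t.
  have par (x : int) : exists y, x ^+ 2 = x + 2 * y.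
    have [q [ex|ex]] := mod2_cases x; [exists (2 * q ^+ 2 - q) | exists (2 * q ^+ 2 + q)];
      by rewrite ex; ring.
  have [ya Ya] := par A; have [yb Yb] := par B; have [yc Yc] := par C; have [yd Yd] := par D.
  exists ((n %/ 2)%N%:Z - ya - yb - yc - yd).
  by move: e; rewrite Ya Yb Yc Yd; clear -n6; lia.
have [t et] := ev.
clear ha hb hc hd.
case: ia Ha I => Ha; case: ib Hb => Hb; case: ic Hc => Hc; case: id Hd => Hd // _.
- have [T eT] : exists T, qa + qb + qc + qd = 2 * T.
    by exists (t - 2 - (qa + qb + qc + qd)); clear -et Ha Hb Hc Hd; lia.
  (* Half of the sum of the entries is 2 + 3T; its negative 1 + 3(-1 - T) has the required residue.
     The other three are half of A + B - C - D and its analogues. *)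
  exists (- 1 - T), (qa + qb - T), (qa + qc - T), (qa + qd - T).
  have eqd : qd = 2 * T - qa - qb - qc by clear -eT; lia.
  by rewrite e Ha Hb Hc Hd eqd /= ?mulr0n ?mulr1n; ring.
- by exists qa, qb, qc, qd; rewrite e Ha Hb Hc Hd /= ?mulr0n ?mulr1n; ring.
- by exists qb, qa, qc, qd; rewrite e Ha Hb Hc Hd /= ?mulr0n ?mulr1n; ring.
- by exists qc, qa, qb, qd; rewrite e Ha Hb Hc Hd /= ?mulr0n ?mulr1n; ring.
- by exists qd, qa, qb, qc; rewrite e Ha Hb Hc Hd /= ?mulr0n ?mulr1n; ring.
Qed.

(** * Light words of codes given by explicit generators *)

(* Explicit matrices are lists of rows over the binary integers, so that identities between
   them can be decided by computation. *)
Definition mxl (m n : nat) (l : seq (seq Z)) : 'M[int]_(m, n) :=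
  \matrix_(i, j) int_of_Z (nth 0 (nth [::] l i) j).

Definition shape (m n : nat) (l : seq (seq Z)) : bool :=
  (size l == m) && all (fun r => size r == n) l.

Fixpoint dotl (r s : seq Z) : Z :=
  match r, s with a :: r', b :: s' => Z.add (Z.mul a b) (dotl r' s') | _, _ => Z0 end.

Definition mulT (A B : seq (seq Z)) : seq (seq Z) := [seq [seq dotl r s | s <- B] | r <- A].

Definition scall (n : nat) (a : Z) : seq (seq Z) :=
  [seq [seq if (i == j)%N then a else 0%R | j <- iota 0 n] | i <- iota 0 n].

Definition trl (n : nat) (A : seq (seq Z)) : seq (seq Z) :=
  [seq [seq nth 0 r j | r <- A] | j <- iota 0 n].

Definition dvdl (d : Z) (A : seq (seq Z)) : bool := all (all (fun z => Z.eqb (Z.modulo z d) Z0)) A.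

Lemma shapeP m n l : shape m n l -> size l = m /\ (forall i, (i < m)%N -> size (nth [::] l i) = n).
Proof. by move=> /andP[/eqP sl /(all_nthP [::]) H]; split=> // i; rewrite -sl => /H/eqP. Qed.

Lemma dotlE (r s : seq Z) n : size r = n -> size s = n ->
  dotl r s = \sum_(i < n) nth 0 r i * nth 0 s i.
Proof.
elim: r s n => [|a r IH] [|b s] [|n] //=; rewrite ?big_ord0 // => -[sr] [ss].
by rewrite big_ord_recl /= (IH s n).
Qed.

Lemma mxl_mulT m n p A B : shape m n A -> shape p n B ->
  mxl m n A *m (mxl p n B)^T = mxl m p (mulT A B).
Proof.
move=> /shapeP[sA rA] /shapeP[sB rB]; apply/matrixP => i j; rewrite !mxE.
rewrite (nth_map [::]) ?sA // (nth_map [::]) ?sB // (dotlE (rA _ (ltn_ord i)) (rB _ (ltn_ord j))).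
by rewrite rmorph_sum; apply: eq_bigr => l _; rewrite !mxE rmorphM.
Qed.

Lemma mxl_scall n a : mxl n n (scall n a) = (int_of_Z a)%:M.
Proof.
apply/matrixP => i j; rewrite !mxE (nth_map 0%N) ?size_iota // (nth_map 0%N) ?size_iota //.
by rewrite !nth_iota // !add0n -val_eqE /=; case: eqP => _; rewrite ?mulr1n ?mulr0n.
Qed.

Lemma mxl_trl m n A : shape m n A -> mxl n m (trl n A) = (mxl m n A)^T.
Proof.
move=> /shapeP[sA _]; apply/matrixP => i j; rewrite !mxE (nth_map 0%N) ?size_iota //.
by rewrite nth_iota // (nth_map [::]) ?sA.
Qed.

Section Enumeration.
Variables (D : Type) (nz : D -> bool) (add : D -> D -> D).

Fixpoint vadd (v w : seq D) : seq D :=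
  match v, w with a :: v', b :: w' => add a b :: vadd v' w' | _, _ => [::] end.

Fixpoint heavy (b : nat) (v : seq D) : bool :=
  match v with
  | [::] => false
  | t :: v' => if nz t then (if b is b'.+1 then heavy b' v' else true) else heavy b v'
  end.

(* [rs] lists, for each generator, a level and its nonzero multiples.  All sums of [v] with
   multiples of at most [n] distinct generators are required to have more than [bnd r]
   nonzero entries, where [r] is the unused part of the budget; a generator of level [j]
   may only be used while the budget is at least [j], which is how symmetry is exploited. *)
Fixpoint light_free (bnd : nat -> nat) (rs : seq (nat * seq (seq D))) (n : nat) (v : seq D) : bool :=
  match n, rs with
  | n'.+1, (j, ms) :: rs' =>
      light_free bnd rs' n v &&
      (if Nat.leb j n then
         all (fun r => let w := vadd v r in heavy (bnd n') w && light_free bnd rs' n' w) ms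
       else true)
  | _, _ => true
  end.

Definition multiples (units : seq (D -> D)) (r : seq D) : seq (seq D) := [seq map f r | f <- units].

Variables (R : nzRingType) (phi : D -> R) (units : seq (D -> D)) (d0 : D).
Hypothesis nzE : forall d, nz d = (phi d != 0).
Hypothesis phiD : forall a b, phi (add a b) = phi a + phi b.
Hypothesis unitsP : forall x : R, x != 0 ->
  exists2 i : nat, (i < size units)%N & forall d, phi (nth id units i d) = x * phi d.

Definition rowv (L : nat) (v : seq D) : 'rV[R]_L := \row_j phi (nth d0 v j).

Definition wt (L : nat) (x : 'rV[R]_L) : nat := (\sum_(j < L) (x ord0 j != 0%R))%N.

Lemma heavy_count b v : heavy b v -> (b < count nz v)%N.
Proof. by elim: v b => //= t v IH [|b]; case: (nz t) => //= /IH. Qed.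

Lemma wt_rowv L v : size v = L -> wt (rowv L v) = count nz v.
Proof.
move=> <-; rewrite -sumn_count sumnE big_map (big_nth d0) big_mkord.
by apply: eq_bigr => j _; rewrite mxE nzE.
Qed.

Lemma size_vadd v w : size (vadd v w) = minn (size v) (size w).
Proof. by elim: v w => [|a v IH] [|b w] //=; rewrite IH minnSS. Qed.

Lemma rowv_vadd L v w : size v = L -> size w = L -> rowv L (vadd v w) = rowv L v + rowv L w.
Proof.
move=> sv sw; apply/rowP=> j; rewrite !mxE -phiD; congr phi.
have : (j < size v)%N by rewrite sv.
have : size v = size w by rewrite sv.
move: (nat_of_ord j) => {sv sw} {}j.
by elim: v w j => [|a v IH] [|b w] [|j] //= [e]; apply: IH.
Qed.

Local Arguments Nat.leb : simpl never.

(** The coefficient vectors that [light_free] covers: whenever a nonzero coefficient is spent, the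
    budget still available must be positive and reach the level of its generator. *)
Fixpoint within (js : seq nat) (c : seq R) (n : nat) : bool :=
  match js, c with
  | j :: js', x :: c' =>
      if x == 0 then within js' c' n else [&& (j <= n)%N, (0 < n)%N & within js' c' n.-1]
  | _, _ => true
  end.

Lemma lebE m n : Nat.leb m n = (m <= n)%N.
Proof. by elim: m n => [|m IH] [|n]; [by [] | by [] | by [] | exact: IH]. Qed.

Lemma zip_all0 L (c : seq R) (rows : seq (seq D)) : all (pred1 (0%R : R)) c ->
  \sum_(p <- zip c rows) p.1 *: rowv L p.2 = 0.
Proof.
elim: c rows => [|x c IH] [|r rows] //=; rewrite ?big_nil //.
by move=> /andP[/eqP-> cz]; rewrite big_cons scale0r add0r IH.
Qed.

(** By [unitsP] every nonzero coefficient is realized by one of the listed multiples. A vector is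
    tested only when a multiple has just been added, never at the start, hence the condition that
    [c] has a nonzero entry. *)
Lemma light_freeP bnd L (js : seq nat) (rows : seq (seq D)) n v (c : seq R) :
  size js = size rows -> size c = size rows -> size v = L -> all (fun r => size r == L) rows ->
  light_free bnd (zip js (map (multiples units) rows)) n v ->
  within js c n -> has (predC1 (0%R : R)) c ->
  (bnd (n - count (predC1 (0%R : R)) c) <
     wt (rowv L v + \sum_(p <- zip c rows) p.1 *: rowv L p.2))%N.
Proof.
elim: rows js n v c => [|r rows IH] [|j js] n v [|x c] //= [sj] [sc] sv /andP[/eqP sr srs].
rewrite big_cons /=.
case: (eqVneq x 0) => [->|x0] /=.
  move=> lf wi hc; rewrite scale0r add0r add0n; apply: (IH js) => //.
  by case: n lf {wi} => [_|n /andP[]//]; case: (zip _ _).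
case: n => [|n]; first by rewrite ltnn andbF.
move=> /andP[lf].
rewrite lebE => H /and3P[jn _ wi] _; rewrite {}jn in H.
have [i iu ui] := unitsP x0.
move/(all_nthP [::])/(_ i): H; rewrite size_map => /(_ iu).
rewrite (nth_map id) // => /andP[hv {}lf].
set w := vadd v _ in hv lf.
have sw : size w = L by rewrite size_vadd size_map sv sr minnn.
have ew : rowv L w = rowv L v + x *: rowv L r.
  rewrite rowv_vadd // ?size_map //; congr (_ + _); apply/rowP=> k; rewrite !mxE.
  by rewrite (nth_map d0) ?ui // sr.
rewrite addrA -ew add1n subSS.
case hc: (has (predC1 (0%R : R)) c); first exact: (IH js).
have cz : all (pred1 (0%R : R)) c.
  by move/negbT: hc; rewrite -all_predC; apply: sub_all => y /=; rewrite negbK.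
rewrite (zip_all0 _ _ cz).
rewrite addr0 wt_rowv //.
have -> : count (predC1 (0%R : R)) c = 0%N.
  by apply/eqP; rewrite -leqn0 leqNgt -has_count hc.
by rewrite subn0; exact: heavy_count.
Qed.

Lemma within_nseq p (c : seq R) n :
  (count (predC1 (0%R : R)) c <= n)%N -> within (nseq p 0%N) c n.
Proof.
elim: p c n => [|p IH] [|x c] n //=.
case: eqP => [_|_] /=; first exact: IH.
by case: n => // n; rewrite add1n => /IH.
Qed.

Variable ofZ : Z -> D.
Hypothesis ofZE : forall z, phi (ofZ z) = (int_of_Z z)%:~R.

Lemma count_rV p (c : 'rV[R]_p) : count (predC1 (0%R : R)) [seq c ord0 i | i <- enum 'I_p] = wt c.
Proof.
by rewrite count_map -sumn_count sumnE big_map big_enum /=; apply: eq_bigr => i _.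
Qed.

Lemma rowv_ofZ L r : (size r <= L)%N -> d0 = ofZ 0 ->
  rowv L (map ofZ r) = \row_j (int_of_Z (nth 0%R r j))%:~R.
Proof.
move=> sr d00; apply/rowP => j; rewrite !mxE -ofZE; congr phi.
have [jr|jr] := ltnP j (size r); first by rewrite (nth_map 0%R).
by rewrite !nth_default ?size_map.
Qed.

Lemma mulmx_zip p L (l : seq (seq Z)) (c : 'rV[R]_p) : shape p L l -> d0 = ofZ 0 ->
  c *m map_mx intr (mxl p L l) =
  \sum_(q <- zip [seq c ord0 i | i <- enum 'I_p] (map (map ofZ) l)) q.1 *: rowv L q.2.
Proof.
move=> /shapeP[sl sr] d00; rewrite mulmx_sum_row [RHS](big_nth (0, [::])).
have sc : size [seq c ord0 i | i <- enum 'I_p] = p by rewrite size_map size_enum_ord.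
have sl' : size (map (map ofZ) l) = p by rewrite size_map.
rewrite size_zip sc sl' minnn big_mkord; apply: eq_bigr => i _.
rewrite nth_zip ?sc ?sl' //= (nth_map i) ?size_enum_ord // nth_ord_enum.
rewrite (nth_map [::]) ?sl // rowv_ofZ //; last by rewrite sr.
by congr (_ *: _); apply/rowP => j; rewrite !mxE.
Qed.

Lemma light_free_mx bnd p L (l : seq (seq Z)) n (c : 'rV[R]_p) : shape p L l -> d0 = ofZ 0 ->
  light_free bnd (zip (nseq p 0%N) (map (multiples units) (map (map ofZ) l))) n (nseq L d0) ->
  c != 0 -> (wt c <= n)%N -> (bnd (n - wt c) < wt (c *m map_mx intr (mxl p L l)))%N.
Proof.
move=> sh d00 lf c0 cn; have /andP[/eqP sl /allP sr] := sh.
rewrite (mulmx_zip c sh d00) -count_rV.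
have -> : \sum_(q <- zip [seq c ord0 i | i <- enum 'I_p] (map (map ofZ) l)) q.1 *: rowv L q.2
  = rowv L (nseq L d0) +
    \sum_(q <- zip [seq c ord0 i | i <- enum 'I_p] (map (map ofZ) l)) q.1 *: rowv L q.2.
  rewrite (_ : rowv L (nseq L d0) = 0) ?add0r //; apply/rowP => j.
  by rewrite !mxE nth_nseq if_same d00 ofZE.
have sc : size [seq c ord0 i | i <- enum 'I_p] = p by rewrite size_map size_enum_ord.
have sl' : size (map (map ofZ) l) = p by rewrite size_map.
apply: light_freeP lf _ _; rewrite ?size_nseq ?sc ?sl' //.
- by rewrite all_map; case/andP: sh => _; apply: sub_all => r /=; rewrite size_map.
- by apply: within_nseq; rewrite count_rV.
- move: c0; apply: contraR => /hasPn h; apply/eqP/rowP => i; rewrite mxE.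
  by have := h (c ord0 i) (map_f _ (mem_enum _ i)); rewrite /= negbK => /eqP.
Qed.

End Enumeration.

(** * From lattices to Type II codes *)

Definition dotr (R : pzRingType) n (x y : 'rV[R]_n) : R := \sum_i x ord0 i * y ord0 i.

Definition dvdmx (d : int) m n (A : 'M[int]_(m, n)) : bool :=
  [forall i, forall j, (d %| A i j)%Z].

Lemma dvdmxP d m n (A : 'M[int]_(m, n)) : reflect (exists B, A = d *: B) (dvdmx d A).
Proof.
apply: (iffP forallP) => [H | [B ->] i]; last first.
  by apply/forallP => j; rewrite mxE dvdz_mulr.
exists (\matrix_(i, j) (A i j %/ d)%Z); apply/matrixP => i j.
by rewrite !mxE mulrC divzK //; have /forallP := H i.
Qed.

Lemma Zp_int_eq0 (m : nat) (z : int) : (1 < m)%N -> (z%:~R == 0 :> 'Z_m) = (m %| z)%Z.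
Proof.
move=> m1.
have H (n : nat) : (n%:R == 0 :> 'Z_m) = (m %| n)%N.
  by rewrite -val_eqE /= val_Zp_nat.
case: z => n; first by rewrite -pmulrn H dvdzE.
by rewrite NegzE mulrNz oppr_eq0 -pmulrn H dvdzE abszN.
Qed.

Lemma map_intr_eq0 (m n : nat) (x : 'rV[int]_n) : (1 < m)%N ->
  (map_mx intr x == 0 :> 'rV['Z_m]_n) = dvdmx m x.
Proof.
move=> m1; apply/eqP/forallP => [/rowP e i | H].
  by apply/forallP => j; rewrite ord1 -Zp_int_eq0 //; move: (e j); rewrite !mxE => ->.
by apply/rowP => j; rewrite !mxE; apply/eqP; rewrite Zp_int_eq0 //; exact: (forallP (H ord0)).
Qed.

Section CodeOfLattice.
Variables (k n : nat).
Hypothesis k_gt0 : (0 < k)%N.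
Let m := (2 * k)%N.

Let m_gt1 : (1 < m)%N. Proof. by rewrite /m; lia. Qed.

Definition redv (x : 'rV[int]_n) : 'rV['Z_m]_n := map_mx intr x.
Definition centered (a : 'Z_m) : int := if (2 * val a <= m)%N then (val a)%:Z else (val a)%:Z - m%:Z.

Lemma redv_eq x y : redv x = redv y -> exists q, y = x + m%:Z *: q.
Proof.
move=> e; have /dvdmxP[q eq] : dvdmx m (y - x).
  apply/forallP => i; apply/forallP => j; rewrite -Zp_int_eq0 // !mxE rmorphB subr_eq0 /=.
  by move/matrixP/(_ i j): e; rewrite !mxE => ->.
by exists q; rewrite -eq addrC subrK.
Qed.

Lemma centeredK (a : 'Z_m) : (centered a)%:~R = a.
Proof.
rewrite /centered; case: ifP => _; first by rewrite -pmulrn natr_Zp.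
by rewrite rmorphB /= -!pmulrn natr_Zp pchar_Zp // subr0.
Qed.

Lemma centered_sqr (a : 'Z_m) : centered a ^+ 2 = ((minn (val a) (m - val a)) ^ 2)%N%:Z.
Proof.
have : (val a < m)%N by rewrite -[X in (_ < X)%N](Zp_cast m_gt1); apply: ltn_ord.
rewrite /centered; set v := val a; move: (m) v => M v vm; case: ifP => h.
  by have -> : minn v (M - v) = v by lia.
have -> : minn v (M - v) = (M - v)%N by lia.
have -> : v%:Z - M%:Z = - (M - v)%N%:Z by lia.
by rewrite sqrrN expr2 -mulnn PoszM.
Qed.

Lemma euclid_weightE (x : 'rV['Z_m]_n) :
  (euclid_weight x)%:Z = \sum_i centered (x ord0 i) ^+ 2.
Proof.
by rewrite /euclid_weight -natz natr_sum; apply: eq_bigr => i _; rewrite centered_sqr natz.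
Qed.

Lemma centered_min (z : int) : centered z%:~R ^+ 2 <= z ^+ 2.
Proof.
have : (m %| z - centered z%:~R)%Z by rewrite -Zp_int_eq0 // rmorphB /= centeredK subrr.
have : - m%:Z <= 2 * centered z%:~R <= m%:Z.
  have : (val (z%:~R : 'Z_m) < m)%N by rewrite -[X in (_ < X)%N](Zp_cast m_gt1); apply: ltn_ord.
  by rewrite /centered; case: ifP; lia.
move: (centered _) => c cm /dvdzP[q e].
have {e} -> : z = c + q * m by rewrite -e addrC subrK.
move: (m%:Z) cm => M /andP[h1 h2]; rewrite -subr_ge0.
have -> : (c + q * M) ^+ 2 - c ^+ 2 = M * (q * (2 * c + q * M)) by ring.
apply: mulr_ge0; first by lia.
have [q0|q0|->] := ltrgtP q 0; last by rewrite mul0r.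
  by rewrite nmulr_rge0 //; nia.
by rewrite pmulr_rge0 //; nia.
Qed.

Lemma euclid_weight_le x : (euclid_weight (redv x))%:Z <= dotr x x.
Proof.
rewrite euclid_weightE; apply: ler_sum => i _; rewrite mxE -expr2; exact: centered_min.
Qed.

Lemma inner_redv x y : inner (redv x) (redv y) = (dotr x y)%:~R.
Proof.
by rewrite /inner /dotr rmorph_sum; apply: eq_bigr => i _; rewrite !mxE rmorphM.
Qed.

Definition liftv (c : 'rV['Z_m]_n) : 'rV[int]_n := map_mx centered c.

Lemma liftvK c : redv (liftv c) = c.
Proof. by apply/rowP => i; rewrite !mxE centeredK. Qed.

Lemma euclid_weight_lift c : (euclid_weight c)%:Z = dotr (liftv c) (liftv c).
Proof. by rewrite euclid_weightE; apply: eq_bigr => i _; rewrite mxE expr2. Qed.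

Lemma redv_eq0 x : (redv x == 0) = dvdmx m x.
Proof. exact: map_intr_eq0. Qed.

(* [P] describes the lattice of all integer lifts of the codewords. *)
Lemma code_of_lattice (d : nat) (P : pred 'rV[int]_n) :
  (forall x y, P x -> P y -> P (x + y)) -> (forall a x, P x -> P (a *: x)) ->
  (forall x, P (m%:Z *: x)) ->
  (forall x y, P x -> P y -> (m %| dotr x y)%Z) ->
  (forall x, (forall y, P y -> (m %| dotr x y)%Z) -> P x) ->
  (forall x, P x -> ((4 * k)%N %| dotr x x)%Z) ->
  (forall x, P x -> ~~ dvdmx m x -> d%:Z <= dotr x x) ->
  (exists x, [/\ P x, ~~ dvdmx m x & dotr x x = d]) ->
  exists C : {set 'rV['Z_(2 * k)]_n}, typeII C /\ min_euclid_weight C d.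
Proof.
move=> PD PZ Pm Pint Pdual Pev Pmin [x [Px x0 xd]].
pose C : {set 'rV['Z_m]_n} := [set c | P (liftv c)].
have PC y : (redv y \in C) = P y.
  have [q e] : exists q, y = liftv (redv y) + m%:Z *: q by apply: redv_eq; rewrite liftvK.
  rewrite inE; apply/idP/idP => h; first by rewrite e PD.
  have -> : liftv (redv y) = y + m%:Z *: (- q) by rewrite [X in X + _]e scalerN addrK.
  by rewrite PD.
have Cmin c : c \in C -> c != 0 -> (d <= euclid_weight c)%N.
  rewrite -[c]liftvK PC redv_eq0 => Pc c0.
  by rewrite -lez_nat liftvK euclid_weight_lift Pmin.
exists C; split; [split | split].
- split.
  + by rewrite -(_ : redv 0 = 0) ?PC; [rewrite -(scaler0 _ m%:Z) | apply/rowP => i; rewrite !mxE].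
  + move=> a b; rewrite -[a]liftvK -[b]liftvK !PC => Pa Pb.
    rewrite (_ : _ + _ = redv (liftv a + liftv b)) ?PC ?PD //.
    by apply/rowP => i; rewrite !mxE rmorphD.
  + move=> a b; rewrite -[b]liftvK PC => Pb.
    rewrite (_ : _ *: _ = redv (centered a *: liftv b)) ?PC ?PZ //.
    by apply/rowP => i; rewrite !mxE rmorphM /= !centeredK.
- apply/setP => c; rewrite [RHS]inE -[c]liftvK PC; apply/idP/forallP.
    move=> Pc y; apply/implyP; rewrite -[y]liftvK PC => Py.
    by rewrite inner_redv Zp_int_eq0 // Pint.
  move=> H; apply: Pdual => y Py; rewrite -Zp_int_eq0 // -inner_redv.
  by have := H (redv y); rewrite PC Py.
- by move=> c; rewrite -[c]liftvK PC => Pc; have := Pev _ Pc; rewrite -euclid_weight_lift liftvK dvdzE.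
- exists (redv x); first by rewrite PC.
  rewrite redv_eq0 x0 /= eqn_leq Cmin ?PC ?redv_eq0 // andbT.
  by rewrite -lez_nat -xd euclid_weight_le.
- exact: Cmin.
Qed.

End CodeOfLattice.

(** Over the rationals, [B] divided by [a] is a right inverse of the square matrix [A], hence also a
    left inverse. *)
Lemma scalar_mul_comm n (a : int) (A B : 'M[int]_n) :
  a != 0 -> A *m B = a%:M -> B *m A = a%:M.
Proof.
move=> a0 AB.
suff : map_mx (intr : int -> rat) (B *m A) = map_mx (intr : int -> rat) a%:M.
  by move/matrixP=> e; apply/matrixP => i j; have := e i j; rewrite !mxE => /intr_inj.
rewrite map_mxM map_scalar_mx /=.
move/(congr1 (map_mx (intr : int -> rat))): AB; rewrite map_mxM map_scalar_mx /= => AB.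
have a0' : a%:~R != 0 :> rat by rewrite intr_eq0.
have /mulmx1C : map_mx intr A *m ((a%:~R)^-1 *: map_mx intr B) = 1%:M :> 'M[rat]_n.
  by rewrite -scalemxAr AB scale_scalar_mx mulVf.
by rewrite -scalemxAl => /(congr1 ( *:%R a%:~R)); rewrite scalerA mulfV // scale1r scalemx1.
Qed.

Lemma dotrE n (x y : 'rV[int]_n) : dotr x y = (x *m y^T) ord0 ord0.
Proof. by rewrite mxE; apply: eq_bigr => i _; rewrite mxE. Qed.

Lemma scalemx_inj (a : int) m n (A B : 'M[int]_(m, n)) : a != 0 -> a *: A = a *: B -> A = B.
Proof.
by move=> a0 /matrixP e; apply/matrixP => i j; have := e i j; rewrite !mxE => /(mulfI a0).
Qed.

(** [U = T + T^T] with [T] upper triangular and half of the diagonal of [U] on its own, so the form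
    is twice an integer. This lifts the Type II condition from generators to all words. *)
Lemma quad_even n (U : 'M[int]_n) (z : 'rV[int]_n) :
  U^T = U -> (forall i, (2 %| U i i)%Z) -> (2 %| (z *m U *m z^T) ord0 ord0)%Z.
Proof.
move=> Us Ud.
pose T : 'M[int]_n := \matrix_(i, j) if (i < j)%N then U i j else if i == j then (U i i %/ 2)%Z else 0.
have -> : U = T + T^T.
  apply/matrixP => i j; rewrite !mxE [j == i]eq_sym.
  have [ij|ij|/val_inj ->] := ltngtP i j.
  - by rewrite (_ : (i == j) = false) ?addr0 //; apply/eqP => e; rewrite e ltnn in ij.
  - rewrite (_ : (i == j) = false) ?add0r; last by apply/eqP => e; rewrite e ltnn in ij.
    by rewrite -[in LHS]Us mxE.
  - by rewrite eqxx; have := divzK (Ud j); lia.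
rewrite mulmxDr mulmxDl mxE.
have -> : z *m T^T *m z^T = (z *m T *m z^T)^T by rewrite !trmx_mul trmxK mulmxA.
rewrite [X in (_ %| _ + X)%Z]mxE; apply/dvdzP; exists ((z *m T *m z^T) ord0 ord0); by rewrite mulr_natr mulr2n.
Qed.

(* The rows of [G] and of [H] generate a code and its dual; as [H] is self-orthogonal modulo [m],
   the dual is contained in the code. *)
Section CodeOfBases.
Variables (k n : nat) (G H : 'M[int]_n).
Hypothesis k_gt0 : (0 < k)%N.
Let m : int := (2 * k)%N.
Hypothesis GH : G *m H^T = m%:M.
Hypothesis GG : dvdmx m (G *m G^T).
Hypothesis GGd : forall i, ((4 * k)%N %| (G *m G^T) i i)%Z.
Hypothesis HH : dvdmx m (H *m H^T).

Let m0 : m != 0. Proof. by rewrite /m; clear -k_gt0; lia. Qed.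

(** If x G^T = m t, then G^T H = m gives x = t H; and writing H H^T = m V, the relation H^T G = m
    gives H = V G. *)
Lemma basis_span x : dvdmx m (x *m G^T) -> exists z : 'rV_n, x = z *m G.
Proof.
move=> /dvdmxP[t e]; have [V eV] := dvdmxP _ _ HH.
have HG : H^T *m G = m%:M by apply: scalar_mul_comm.
have eH : H = V *m G.
  by apply: (scalemx_inj m0); rewrite scalemxAl -eV -mulmxA HG mul_mx_scalar.
exists (t *m V); rewrite -mulmxA -eH; apply: (scalemx_inj m0).
rewrite scalemxAl -e -mulmxA -[G^T *m H]trmxK trmx_mul trmxK HG tr_scalar_mx mul_mx_scalar //.
Qed.

Lemma basis_norm_dvd x : dvdmx m (x *m G^T) -> ((4 * k)%N %| dotr x x)%Z.
Proof.
move=> /basis_span[z ->]; have /dvdmxP[U eU] := GG.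
rewrite dotrE trmx_mul mulmxA -[z *m G *m _]mulmxA eU -scalemxAr -scalemxAl mxE.
rewrite (_ : ((4 * k)%N : int) = m * 2) ?dvdz_mul2l //; last by rewrite /m; lia.
apply: quad_even.
  by apply: (scalemx_inj m0); rewrite -linearZ /= -eU trmx_mul trmxK.
move=> i; have := GGd i; rewrite eU mxE (_ : ((4 * k)%N : int) = m * 2) ?dvdz_mul2l //.
by rewrite /m; lia.
Qed.

Lemma code_of_bases (d : nat) :
  (forall x : 'rV_n, dvdmx m (x *m G^T) -> ~~ dvdmx m x -> d%:Z <= dotr x x) ->
  (exists x : 'rV_n, [/\ dvdmx m (x *m G^T), ~~ dvdmx m x & dotr x x = d]) ->
  exists C : {set 'rV['Z_(2 * k)]_n}, typeII C /\ min_euclid_weight C d.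
Proof.
pose P (x : 'rV_n) := dvdmx m (x *m G^T).
apply: (@code_of_lattice k n k_gt0 d P).
- move=> x y /dvdmxP[a ea] /dvdmxP[b eb]; apply/dvdmxP; exists (a + b).
  by rewrite mulmxDl ea eb scalerDr.
- move=> a x /dvdmxP[b eb]; apply/dvdmxP; exists (a *: b).
  by rewrite -scalemxAl eb !scalerA mulrC.
- by move=> x; apply/dvdmxP; exists (x *m G^T); rewrite -scalemxAl.
- move=> x y /basis_span[z ->] /dvdmxP[s es].
  rewrite dotrE -mulmxA -[G]trmxK -trmx_mul es linearZ /= -scalemxAr mxE.
  exact: dvdz_mulr.
- move=> x h; apply/forallP => i; apply/forallP => j; rewrite ord1.
  have -> : (x *m G^T) ord0 j = dotr x (row j G).
    by rewrite /dotr mxE; apply: eq_bigr => l _; rewrite !mxE.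
  apply: h; apply/dvdmxP; have /dvdmxP[U eU] := GG.
  by exists (row j U); rewrite -row_mul eU linearZ.
- exact: basis_norm_dvd.
Qed.

End CodeOfBases.

Lemma int_of_Z_dvd z d : Z.eqb (Z.modulo z d) Z0 -> (int_of_Z d %| int_of_Z z)%Z.
Proof.
move/Z.eqb_spec => e; have [d0|d0] := Z.eq_dec d Z0.
  by move: e; rewrite d0 Zmod_0_r => ->; rewrite dvdzz.
have [q ->] := Znumtheory.Zmod_divide z d d0 e.
by rewrite (rmorphM int_of_Z) dvdz_mull.
Qed.

Lemma dvdl_mx d m n l : dvdl d l -> dvdmx (int_of_Z d) (mxl m n l).
Proof.
move=> H; apply/forallP => i; apply/forallP => j; rewrite mxE.
have [il|il] := ltnP i (size l); last by rewrite [nth [::] l i]nth_default // nth_nil dvdz0.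
have := (all_nthP [::] H) i il; have [jl|jl] := ltnP j (size (nth [::] l i)); last first.
  by rewrite [nth 0 _ j]nth_default // dvdz0.
move/(all_nthP 0)/(_ j jl); exact: int_of_Z_dvd.
Qed.

Definition dvdl_diagb (d : Z) n (l : seq (seq Z)) : bool :=
  all (fun i => Z.eqb (Z.modulo (nth 0 (nth [::] l i) i) d) Z0) (iota 0 n).

Lemma dvdl_diag d n l : dvdl_diagb d n l -> forall i, (int_of_Z d %| mxl n n l i i)%Z.
Proof.
move/allP=> h i; rewrite mxE; apply/int_of_Z_dvd/h.
by rewrite mem_iota ltn_ord.
Qed.

Lemma wt_le_dotr (R : nzRingType) n (x : 'rV[int]_n) :
  (wt (map_mx intr x : 'rV[R]_n))%:Z <= dotr x x.
Proof.
rewrite /wt -natz natr_sum; apply: ler_sum => i _; rewrite mxE natz -expr2.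
case: eqP => [_|e]; first exact: sqr_ge0.
have : x ord0 i != 0 by apply/eqP => x0; apply: e; rewrite x0.
move: (x _ _) => z z0; have : 0 < z ^+ 2 by rewrite exprn_even_gt0.
by lia.
Qed.

Lemma wt_eq0 (R : nzRingType) n (x : 'rV[R]_n) : (wt x == 0%N) = (x == 0).
Proof.
apply/idP/eqP => [|->]; last by rewrite /wt big1 // => i _; rewrite mxE eqxx.
rewrite /wt sum_nat_eq0 => /forallP h; apply/rowP => i; rewrite mxE.
by have := h i; rewrite eqb0 negbK => /eqP.
Qed.

(** * Enumeration over Z_2 with bits *)

Lemma bool_nzE (b : bool) : id b = ((b%:R : 'Z_2) != 0). Proof. by case: b. Qed.

Lemma bool_addE (a b : bool) : ((a (+) b)%:R : 'Z_2) = a%:R + b%:R.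
Proof. by case: a; case: b; apply/val_inj. Qed.

Lemma bool_unitsP (x : 'Z_2) : x != 0 ->
  exists2 i : nat, (i < size [:: @id bool])%N &
    forall b : bool, ((nth id [:: @id bool] i b)%:R : 'Z_2) = x * b%:R.
Proof.
move=> x0; exists 0%N => // b /=; suff -> : x = 1 by rewrite mul1r.
by case: x x0 => [[|[|//]] p] // _; apply: val_inj.
Qed.

Lemma bool_ofZE (z : Z) : ((Z.odd z)%:R : 'Z_2) = (int_of_Z z)%:~R.
Proof.
rewrite {2}(Z.div2_odd z) rmorphD rmorphM /= rmorphD rmorphM /=.
have -> : (int_of_Z 2)%:~R = 0 :> 'Z_2 by apply/val_inj.
by rewrite mul0r add0r; case: (Z.odd z); apply/val_inj.
Qed.

Definition bit_light_free bnd (l : seq (seq Z)) n :=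
  light_free id addb bnd (zip (nseq (size l) 0%N) (map (multiples [:: id]) (map (map Z.odd) l)))
    n (nseq (size (head [::] l)) false).

Lemma bit_light_freeP bnd p L (l : seq (seq Z)) n (c : 'rV['Z_2]_p.+1) :
  shape p.+1 L l -> bit_light_free bnd l n -> c != 0 -> (wt c <= n)%N ->
  (bnd (n - wt c) < wt (c *m map_mx intr (mxl p.+1 L l)))%N.
Proof.
move=> sh; have [sl sr] := shapeP sh; rewrite /bit_light_free sl -nth0 sr //.
exact: (light_free_mx bool_nzE bool_addE bool_unitsP bool_ofZE).
Qed.

(** * The codes over Z_2 and Z_4 *)

Definition bordered_circulant : seq (seq Z) :=
  (0%coqZ :: nseq 27 1%coqZ) ::
  [seq 1%coqZ :: rotr i [:: 0; 1; 0; 0; 1; 0; 1; 1; 0; 0; 1; 1; 1; 0; 0; 1; 0; 1; 0; 1; 0; 1; 1; 1; 0; 1; 0]%coqZ | i <- iota 0 27].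

Definition hcat (A B : seq (seq Z)) : seq (seq Z) := [seq p.1 ++ p.2 | p <- zip A B].
Definition negl : seq (seq Z) -> seq (seq Z) := map (map Z.opp).

Lemma mxl_cat m1 m2 n A B : shape m1 n A -> mxl (m1 + m2) n (A ++ B) = col_mx (mxl m1 n A) (mxl m2 n B).
Proof.
move=> /shapeP[sA _]; apply/matrixP => i j; rewrite !mxE nth_cat sA.
by case: splitP => k e; rewrite !mxE e ?addKn.
Qed.

Lemma mxl_hcat m n1 n2 A B : shape m n1 A -> shape m n2 B ->
  mxl m (n1 + n2) (hcat A B) = row_mx (mxl m n1 A) (mxl m n2 B).
Proof.
move=> /shapeP[sA rA] /shapeP[sB rB]; apply/matrixP => i j; rewrite !mxE.
rewrite (nth_map ([::], [::])) ?size_zip ?sA ?sB ?minnn // nth_zip ?sA ?sB //= nth_cat rA //.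
by case: splitP => k e; rewrite !mxE e ?addKn.
Qed.

Lemma wt_row_mx (R : nzRingType) n1 n2 (a : 'rV[R]_n1) (b : 'rV[R]_n2) :
  wt (row_mx a b) = (wt a + wt b)%N.
Proof.
by rewrite /wt big_split_ord; congr (_ + _)%N; apply: eq_bigr => i _; rewrite ?row_mxEl ?row_mxEr.
Qed.

Lemma wt_le_dim (R : nzRingType) n (b : 'rV[R]_n) : (wt b <= n)%N.
Proof.
by rewrite /wt -[X in (_ <= X)%N]card_ord -sum1_card leq_sum // => i _; apply: leq_b1.
Qed.

Lemma wt_opp (R : nzRingType) n (b : 'rV[R]_n) : wt (- b) = wt b.
Proof. by apply: eq_bigr => i _; rewrite mxE oppr_eq0. Qed.

(** Lets a norm bound be proved only beyond the previous multiple: past 8 for 12, past 16 for 24,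
    past 48 for 72. *)
Lemma dvdz_leS (d a b : int) : (d %| a)%Z -> (d %| b)%Z -> 0 < d -> b - d < a -> b <= a.
Proof.
move=> /dvdzP[q ->] /dvdzP[r ->] d0 h; rewrite ler_pM2r //.
have : (r - 1) * d < q * d by rewrite mulrBl mul1r.
by rewrite ltr_pM2r //; lia.
Qed.

(** The block matrix (1, A; 0, 2), whose integer row span consists of all lifts of the code.
    [binary_dual] is twice its inverse transpose. *)
Definition binary_gen := hcat (scall 28 1%coqZ) bordered_circulant ++
                         hcat (scall 28 0%coqZ) (scall 28 2%coqZ).
Definition binary_dual := hcat (scall 28 2%coqZ) (scall 28 0%coqZ) ++
                         hcat (negl (trl 28 bordered_circulant)) (scall 28 1%coqZ).

Definition binary_word : seq Z :=
  [:: 0; 1; 0; 0; 0; 0; 0; 1; 0; 0; 0; 0; 0; 0; 0; 0; 0; 0; 0; 0; 0; 0; 0; 0; 0; 0; 0; 0; 0; 1; 0; 1; 0; 0; 0; 1; 0; 0; 0; 0; 1; 0; 1; 0; 1; 1; 0; 1; 1; 0; 0; 1; 0; 0; 0; 0]%coqZ.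

Lemma dotr_mxl n w : shape 1 n [:: w] ->
  dotr (mxl 1 n [:: w]) (mxl 1 n [:: w]) = int_of_Z (dotl w w).
Proof. by move=> sw; rewrite dotrE mxl_mulT // mxE. Qed.

Lemma extremal_code1 : exists C : {set 'rV['Z_(2 * 1)]_56}, extremal_typeII C.
Proof.
pose A := mxl 28 28 bordered_circulant.
(* Weights are divisible by 4, so it suffices to exclude words (a, a A) of weight at most 8; there
   one half has weight at most 4, and each half determines the other. *)
pose G : 'M_(28 + 28) := mxl 56 56 binary_gen; pose H : 'M_(28 + 28) := mxl 56 56 binary_dual.
have sG : shape 56 56 binary_gen by vm_compute.
have sH : shape 56 56 binary_dual by vm_compute.
have sA : shape 28 28 bordered_circulant by vm_compute.
have sAt : shape 28 28 (trl 28 bordered_circulant) by vm_compute.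
have s1 : shape 28 28 (scall 28 1%coqZ) by vm_compute.
have s0 : shape 28 28 (scall 28 0%coqZ) by vm_compute.
have s2 : shape 28 28 (scall 28 2%coqZ) by vm_compute.
have EG : G = block_mx 1%:M A 0 2%:M.
  rewrite /G (@mxl_cat 28 28 56); last by vm_compute.
  by rewrite !(@mxl_hcat _ 28 28) // !mxl_scall /= raddf0.
have eGG : G *m G^T = mxl 56 56 (mulT binary_gen binary_gen) by exact: mxl_mulT.
have GH : G *m H^T = 2%:M.
  rewrite (mxl_mulT sG sH).
  have -> : mulT binary_gen binary_dual = scall 56 2%coqZ by vm_compute.
  exact: mxl_scall.
have GG : dvdmx 2 (G *m G^T).
  by rewrite eGG; apply: (@dvdl_mx 2%coqZ); vm_compute.
have GGd i : (4%N %| (G *m G^T) i i)%Z.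
  by rewrite eGG; apply: (@dvdl_diag 4%coqZ); vm_compute.
have HH : dvdmx 2 (H *m H^T).
  by rewrite (mxl_mulT sH sH); apply: (@dvdl_mx 2%coqZ); vm_compute.
apply: (@code_of_bases 1 (28 + 28) G H isT GH GG GGd HH) => [x Px x0 | ]; last first.
  (* A word of weight 12: the sum mod 2 of the two generators marked by its first half. *)
  exists (mxl 1 56 [:: binary_word]); split.
  - rewrite (_ : _ *m _ = mxl 1 56 (mulT [:: binary_word] binary_gen)); last exact: mxl_mulT.
    by apply: (@dvdl_mx 2%coqZ); vm_compute.
  - apply/negP => /forallP/(_ ord0)/forallP/(_ (inord 1)); rewrite !mxE inordK //.
  - by rewrite dotr_mxl //; vm_compute.
have [z ez] := basis_span (isT : (0 < 1)%N) GH HH Px.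
have dx := basis_norm_dvd (isT : (0 < 1)%N) GH GG GGd HH Px.
apply: (@dvdz_leS 4) => //.
suff : (9 <= wt (map_mx intr x : 'rV['Z_2]_(28 + 28)))%N.
  move=> h9; have := wt_le_dotr 'Z_2 x; move: (dotr x x) (wt _) h9 => u v; clear.
  by rewrite (_ : (_ * (56 %/ 24) + _)%N = 12%N) //; lia.
pose A2 : 'M['Z_2]_28 := map_mx intr A.
pose a : 'rV['Z_2]_28 := map_mx intr (lsubmx z); pose b := a *m A2.
have xe : map_mx intr (x : 'rV_(28 + 28)) = row_mx a b.
  rewrite ez EG -[z in LHS]hsubmxK mul_row_block mulmx1 mulmx0 addr0 mul_mx_scalar.
  rewrite map_row_mx map_mxD map_mxM map_mxZ /=.
  by rewrite (_ : 2%:~R = 0) ?scale0r ?addr0 //; apply/val_inj.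
have ba : a = - b *m A2^T.
  move: Px; rewrite -(@map_intr_eq0 2) // map_mxM -map_trmx xe EG map_block_mx.
  rewrite tr_block_mx mul_row_block map_mx1 trmx1 mulmx1 => /eqP.
  rewrite -row_mx0 => /eq_row_mx[/eqP + _].
  by rewrite addr_eq0 mulNmx => /eqP.
rewrite xe wt_row_mx leqNgt; apply/negP => wle.
have xn0 : row_mx a b != 0 by rewrite -xe (@map_intr_eq0 2).
have a0 : a != 0.
  by apply: contraNneq xn0 => a0; rewrite /b a0 mul0mx row_mx0.
have b0 : b != 0.
  by apply: contraNneq a0 => b0; rewrite ba b0 oppr0 mul0mx.
(* With w of the 4 units of budget spent, the bound 4 - w + 4 = 8 - w forces total weight above
   8. *)
have lA : bit_light_free (fun n => n + 4)%N bordered_circulant 4 by vm_compute.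
have lAt : bit_light_free (fun n => n + 4)%N (trl 28 bordered_circulant) 4 by vm_compute.
have [wa|wa] := leqP (wt a) 4.
  have := bit_light_freeP sA lA a0 wa; rewrite -/A -/A2 -/b.
  by move: (wt a) (wt b) wa wle => u v; clear; lia.
have b0' : - b != 0 by rewrite oppr_eq0.
have wb : (wt (- b) <= 4)%N.
  rewrite wt_opp; move: (wt a) (wt b) wa wle => u v; clear; lia.
have := bit_light_freeP sAt lAt b0' wb; rewrite (mxl_trl sA) -map_trmx -/A -/A2 -ba.
rewrite wt_opp; move: (wt a) (wt b) wa wle => u v; clear; lia.
Qed.

Definition z4_top : seq (seq Z) := [::
  [:: 1; 0; 0; 0; 0; 0; 0; 0; 0; 0; 0; 0; 0; 1; 0; 0; 0; 0; 0; 0; 1; 0; 1; 0; 1; 1; 1; 1; 0; 0; 1; 1; 0; 1; 0; 0; 0; 0; 1; 0; 0; 0; 0; 3; 0; 2; 3; 2; 0; 1; 3; 1; 1; 2; 3; 1];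
  [:: 0; 1; 0; 0; 0; 0; 0; 0; 0; 0; 0; 0; 0; 0; 0; 0; 0; 1; 1; 1; 1; 1; 0; 0; 1; 1; 1; 0; 0; 0; 1; 1; 0; 1; 1; 1; 1; 0; 0; 1; 0; 1; 0; 3; 0; 0; 2; 3; 1; 2; 1; 1; 2; 2; 1; 1];
  [:: 0; 0; 1; 0; 0; 0; 0; 0; 0; 0; 0; 0; 0; 0; 0; 1; 0; 1; 0; 0; 0; 1; 0; 1; 1; 1; 1; 0; 1; 1; 1; 1; 0; 1; 1; 0; 1; 1; 0; 0; 1; 1; 1; 1; 2; 0; 2; 0; 0; 1; 2; 1; 2; 3; 3; 0];
  [:: 0; 0; 0; 1; 0; 0; 0; 0; 0; 0; 0; 0; 0; 0; 1; 1; 1; 1; 0; 1; 1; 0; 1; 1; 0; 1; 1; 0; 1; 0; 0; 1; 0; 1; 1; 0; 0; 1; 1; 0; 0; 0; 1; 3; 1; 0; 2; 2; 1; 0; 3; 3; 0; 3; 2; 2];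
  [:: 0; 0; 0; 0; 1; 0; 0; 0; 0; 0; 0; 0; 0; 1; 1; 0; 1; 0; 0; 1; 0; 1; 1; 0; 0; 0; 1; 0; 1; 0; 1; 0; 0; 1; 1; 0; 0; 0; 1; 1; 0; 1; 0; 3; 0; 1; 0; 0; 1; 3; 0; 2; 0; 1; 2; 2];
  [:: 0; 0; 0; 0; 0; 1; 0; 0; 0; 0; 0; 0; 0; 1; 1; 1; 0; 0; 1; 1; 0; 0; 1; 0; 1; 0; 0; 0; 1; 0; 1; 1; 1; 1; 1; 0; 1; 0; 0; 1; 1; 1; 1; 1; 3; 0; 1; 2; 1; 3; 1; 0; 1; 3; 0; 3];
  [:: 0; 0; 0; 0; 0; 0; 1; 0; 0; 0; 0; 0; 0; 1; 0; 0; 1; 1; 1; 0; 0; 0; 1; 0; 1; 1; 0; 1; 1; 0; 1; 1; 0; 0; 1; 0; 0; 1; 0; 0; 1; 0; 1; 1; 2; 1; 0; 1; 3; 3; 1; 0; 1; 0; 2; 1];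
  [:: 0; 0; 0; 0; 0; 0; 0; 1; 0; 0; 0; 0; 0; 1; 1; 0; 0; 1; 1; 1; 1; 0; 0; 1; 1; 0; 0; 1; 1; 0; 1; 0; 1; 1; 0; 1; 1; 0; 0; 0; 0; 1; 0; 1; 1; 0; 0; 0; 1; 0; 0; 1; 1; 1; 1; 0];
  [:: 0; 0; 0; 0; 0; 0; 0; 0; 1; 0; 0; 0; 0; 0; 1; 0; 0; 1; 0; 0; 0; 1; 1; 1; 0; 1; 0; 1; 0; 1; 1; 1; 1; 0; 1; 1; 1; 1; 0; 0; 0; 1; 1; 1; 1; 1; 0; 0; 1; 1; 0; 0; 0; 0; 0; 1];
  [:: 0; 0; 0; 0; 0; 0; 0; 0; 0; 1; 0; 0; 0; 1; 0; 1; 0; 1; 0; 1; 1; 0; 0; 0; 0; 0; 1; 1; 0; 1; 0; 1; 0; 0; 0; 0; 0; 1; 1; 0; 0; 1; 1; 1; 1; 1; 1; 0; 1; 1; 1; 0; 1; 1; 1; 0];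
  [:: 0; 0; 0; 0; 0; 0; 0; 0; 0; 0; 1; 0; 0; 0; 1; 0; 1; 1; 0; 1; 0; 1; 0; 1; 1; 0; 0; 0; 0; 0; 0; 0; 0; 1; 0; 1; 0; 0; 1; 1; 0; 1; 1; 1; 0; 1; 1; 1; 1; 1; 1; 1; 1; 0; 0; 1];
  [:: 0; 0; 0; 0; 0; 0; 0; 0; 0; 0; 0; 1; 0; 1; 0; 1; 0; 0; 0; 1; 0; 0; 0; 1; 0; 1; 0; 1; 1; 1; 1; 0; 1; 1; 1; 1; 0; 0; 0; 1; 1; 1; 1; 1; 0; 0; 1; 1; 0; 1; 1; 0; 0; 0; 1; 0];
  [:: 0; 0; 0; 0; 0; 0; 0; 0; 0; 0; 0; 0; 1; 0; 1; 0; 1; 1; 1; 1; 0; 0; 1; 1; 0; 0; 1; 1; 0; 1; 0; 1; 1; 0; 1; 0; 0; 0; 0; 0; 1; 0; 1; 1; 0; 0; 0; 1; 0; 0; 1; 1; 1; 1; 1; 1]]%coqZ.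

Definition z4_D : seq (seq Z) := [::
  [:: 1; 1; 0; 0; 1; 0; 0; 1; 1; 0; 0; 0; 0];
  [:: 1; 0; 1; 1; 0; 1; 1; 0; 0; 1; 1; 1; 1];
  [:: 0; 0; 1; 0; 1; 0; 0; 0; 0; 1; 1; 0; 1];
  [:: 1; 0; 1; 0; 0; 0; 1; 0; 0; 1; 0; 0; 1];
  [:: 1; 1; 0; 0; 0; 0; 1; 1; 0; 0; 0; 1; 0];
  [:: 1; 1; 0; 0; 1; 1; 0; 0; 1; 1; 0; 0; 1];
  [:: 1; 1; 1; 1; 0; 1; 0; 0; 0; 1; 0; 1; 0];
  [:: 1; 0; 0; 1; 0; 1; 1; 1; 1; 1; 1; 0; 1];
  [:: 1; 0; 0; 1; 1; 0; 0; 1; 0; 1; 0; 0; 0];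
  [:: 0; 0; 0; 0; 1; 0; 0; 1; 1; 0; 1; 0; 1];
  [:: 1; 1; 1; 1; 0; 0; 1; 0; 0; 0; 1; 0; 1];
  [:: 1; 1; 1; 0; 1; 0; 1; 1; 0; 0; 1; 0; 0];
  [:: 0; 0; 0; 1; 0; 0; 0; 1; 0; 1; 0; 1; 1];
  [:: 0; 0; 1; 1; 0; 1; 1; 1; 1; 1; 0; 1; 1];
  [:: 0; 0; 1; 0; 0; 1; 0; 0; 1; 0; 0; 1; 1];
  [:: 0; 1; 1; 0; 1; 1; 0; 1; 1; 0; 1; 1; 1];
  [:: 1; 0; 1; 1; 0; 0; 0; 0; 1; 1; 0; 1; 1];
  [:: 0; 0; 0; 0; 0; 0; 1; 1; 1; 1; 0; 1; 0];
  [:: 1; 0; 0; 0; 1; 0; 0; 0; 1; 1; 1; 0; 0];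
  [:: 0; 1; 1; 0; 0; 0; 0; 0; 0; 0; 1; 1; 1];
  [:: 0; 1; 0; 0; 1; 1; 1; 1; 1; 1; 1; 0; 1];
  [:: 1; 1; 0; 1; 0; 0; 0; 1; 0; 0; 0; 0; 1];
  [:: 1; 0; 1; 1; 1; 0; 1; 0; 0; 0; 1; 1; 0];
  [:: 1; 0; 1; 1; 0; 1; 0; 0; 1; 1; 1; 0; 0];
  [:: 0; 1; 1; 1; 1; 1; 1; 0; 0; 0; 1; 1; 1];
  [:: 0; 1; 0; 0; 0; 0; 0; 0; 1; 1; 1; 0; 1];
  [:: 1; 0; 0; 1; 0; 1; 1; 0; 0; 0; 0; 0; 1];
  [:: 1; 1; 0; 1; 1; 0; 0; 1; 0; 0; 1; 1; 0];
  [:: 1; 1; 0; 0; 0; 0; 0; 1; 1; 1; 0; 1; 1];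
  [:: 0; 1; 1; 1; 1; 0; 1; 1; 1; 1; 0; 1; 0]]%coqZ.

Definition zerol p q : seq (seq Z) := nseq p (nseq q 0%coqZ).
Definition scalel (a : Z) : seq (seq Z) -> seq (seq Z) := map (map (Z.mul a)).
Definition addl (A B : seq (seq Z)) : seq (seq Z) :=
  [seq [seq Z.add q.1 q.2 | q <- zip p.1 p.2] | p <- zip A B].

Definition z4_A := [seq take 30 (drop 13 r) | r <- z4_top].
Definition z4_B := [seq drop 43 r | r <- z4_top].

(** Completes [z4_top] = (1, A, B) to the standard form (1, A, B; 0, 2, 2D; 0, 0, 4) of a code of
    type 4^13 2^30, the last rows generating the multiples of 4. *)
Definition z4_low :=
  hcat (zerol 30 13) (hcat (scall 30 2%coqZ) (scalel 2%coqZ z4_D)) ++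
  hcat (zerol 13 43) (scall 13 4%coqZ).

Definition z4_gen := z4_top ++ z4_low.

(** Four times the inverse transpose of [z4_gen], obtained by inverting the block triangular
    form. *)
Definition z4_dual :=
  hcat (scall 13 4%coqZ) (zerol 13 43) ++
  hcat (scalel (-2)%coqZ (trl 30 z4_A)) (hcat (scall 30 2%coqZ) (zerol 30 13)) ++
  hcat (trl 13 (addl (mulT z4_A (trl 13 z4_D)) (negl z4_B)))
       (hcat (negl (trl 13 z4_D)) (scall 13 1%coqZ)).

Lemma extremal_code2 : exists C : {set 'rV['Z_(2 * 2)]_56}, extremal_typeII C.
Proof.
(* A word that is nonzero mod 2 has at least 20 odd coordinates, and any other one is twice a
   vector orthogonal mod 2 to [z4_top], which has weight at least 5; norms are divisible by 8. *)
pose T : 'M_(13, 56) := mxl 13 56 z4_top.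
pose G : 'M_(13 + 43) := mxl 56 56 z4_gen; pose H : 'M_(13 + 43) := mxl 56 56 z4_dual.
have sG : shape 56 56 z4_gen by vm_compute.
have sH : shape 56 56 z4_dual by vm_compute.
have sT : shape 13 56 z4_top by vm_compute.
have sTt : shape 56 13 (trl 56 z4_top) by vm_compute.
have eGG : G *m G^T = mxl 56 56 (mulT z4_gen z4_gen) by exact: mxl_mulT.
have GH : G *m H^T = 4%:M.
  rewrite (mxl_mulT sG sH).
  have -> : mulT z4_gen z4_dual = scall 56 4%coqZ by vm_compute.
  exact: mxl_scall.
have GG : dvdmx 4 (G *m G^T).
  by rewrite eGG; apply: (@dvdl_mx 4%coqZ); vm_compute.
have GGd i : (8%N %| (G *m G^T) i i)%Z.
  by rewrite eGG; apply: (@dvdl_diag 8%coqZ); vm_compute.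
have HH : dvdmx 4 (H *m H^T).
  by rewrite (mxl_mulT sH sH); apply: (@dvdl_mx 4%coqZ); vm_compute.
have EG : G = col_mx T (mxl 43 56 z4_low) by exact: (@mxl_cat 13 43 56).
apply: (@code_of_bases 2 (13 + 43) G H isT GH GG GGd HH) => [x Px x0 | ]; last first.
  (* The first row of [z4_low] is twice a vector with six entries 1, so its norm is 24. *)
  exists (mxl 1 56 [:: nth [::] z4_gen 13]); split.
  - rewrite (_ : _ *m _ = mxl 1 56 (mulT [:: nth [::] z4_gen 13] z4_gen)); last exact: mxl_mulT.
    by apply: (@dvdl_mx 4%coqZ); vm_compute.
  - by apply/negP => /forallP/(_ ord0)/forallP/(_ (inord 13)); rewrite !mxE inordK.
  - by rewrite dotr_mxl //; vm_compute.
have [z ez] := basis_span (isT : (0 < 2)%N) GH HH Px.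
have dx := basis_norm_dvd (isT : (0 < 2)%N) GH GG GGd HH Px.
apply: (@dvdz_leS 8) => //.
suff : (20 : int) <= dotr x x.
  by move: (dotr x x) => u; clear; rewrite (_ : (_ * (56 %/ 24) + _)%N = 24%N) //; lia.
pose T2 : 'M['Z_2]_(13, 56) := map_mx intr T.
pose c : 'rV['Z_2]_13 := map_mx intr (lsubmx (z : 'rV_(13 + 43))).
have xe : map_mx intr x = c *m T2.
  rewrite ez EG -[z in LHS](@hsubmxK _ _ 13 43) mul_row_col map_mxD !map_mxM.
  have -> : map_mx intr (mxl 43 56 z4_low) = 0 :> 'M['Z_2]_(43, 56).
    have /dvdmxP[S ->] : dvdmx 2 (mxl 43 56 z4_low) by apply: (@dvdl_mx 2%coqZ); vm_compute.
    by rewrite map_mxZ /= (_ : 2%:~R = 0) ?scale0r //; apply/val_inj.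
  by rewrite mulmx0 addr0.
case: (eqVneq c 0) => [c0|c0]; last first.
  (* Budget 13 covers all nonzero words of the residue code. *)
  have lT : bit_light_free (fun=> 19)%N z4_top 13 by vm_compute.
  have := bit_light_freeP sT lT c0 (wt_le_dim c); rewrite -/T -/T2 -xe => h.
  have := wt_le_dotr 'Z_2 x; move: (dotr x x) (wt _) h => u v; clear; lia.
have /dvdmxP[t et] : dvdmx 2 x by rewrite -(@map_intr_eq0 2) // xe c0 mul0mx.
pose t2 : 'rV['Z_2]_56 := map_mx intr t.
have tT : t2 *m T2^T = 0.
  rewrite map_trmx -map_mxM; apply/eqP; rewrite (@map_intr_eq0 2) //.
  have /dvdmxP[s es] := Px; apply/dvdmxP; exists (lsubmx s).
  have es2 : x *m G^T = 2 *: (2 *: s) by rewrite scalerA; exact: es.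
  apply: (@scalemx_inj 2) => //; rewrite scalemxAl -et.
  have -> : 2 *: (2 *: lsubmx s) = lsubmx (x *m G^T).
    by rewrite es2; apply/matrixP => i j; rewrite !mxE.
  by rewrite EG tr_col_mx mul_mx_row row_mxKl.
have t20 : t2 != 0.
  rewrite (@map_intr_eq0 2) //; apply: contra x0 => /dvdmxP[s es].
  by apply/dvdmxP; exists s; rewrite et es scalerA.
have lTt : bit_light_free (fun=> 0)%N (trl 56 z4_top) 4 by vm_compute.
have wt5 : (4 < wt t2)%N.
  rewrite ltnNge; apply/negP => w4.
  have : (0 < wt (t2 *m map_mx intr (mxl 56 13 (trl 56 z4_top))))%N.
    exact: (bit_light_freeP sTt lTt t20 w4).
  by rewrite (mxl_trl sT) -map_trmx -/T -/T2 tT lt0n wt_eq0 eqxx.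
have := wt_le_dotr 'Z_2 t; rewrite -/t2.
have -> : dotr x x = 4 * dotr t t.
  by rewrite et /dotr mulr_sumr; apply: eq_bigr => i _; rewrite !mxE; ring.
by move: (dotr t t) (wt _) wt5 => u v; clear; lia.
Qed.

(** * Minimum weight of quaternionic ternary codes *)

Inductive trit := T0 | T1 | T2.
Definition trit_nz t := match t with T0 => false | _ => true end.
Definition trit_add a b :=
  match a, b with T0, x | x, T0 => x | T1, T1 => T2 | T2, T2 => T1 | _, _ => T0 end.
Definition trit_neg t := match t with T0 => T0 | T1 => T2 | T2 => T1 end.
Definition trit_val t : 'Z_3 := match t with T0 => 0 | T1 => 1 | T2 => -1 end.
Definition trit_of_Z z :=
  match Z.modulo z 3 with Z0 => T0 | Zpos xH => T1 | _ => T2 end.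

Lemma trit_nzE t : trit_nz t = (trit_val t != 0). Proof. by case: t. Qed.

Lemma trit_addE a b : trit_val (trit_add a b) = trit_val a + trit_val b.
Proof. by case: a; case: b; apply/val_inj. Qed.

Lemma Z3_cases (x : 'Z_3) : [\/ x = 0, x = 1 | x = -1].
Proof.
case: x => [[|[|[|//]]] p]; [constructor 1 | constructor 2 | constructor 3]; exact: val_inj.
Qed.

Lemma trit_unitsP (x : 'Z_3) : x != 0 ->
  exists2 i : nat, (i < size [:: id; trit_neg])%N &
    forall t, trit_val (nth id [:: id; trit_neg] i t) = x * trit_val t.
Proof.
have [->|->|->] := Z3_cases x; rewrite ?eqxx // => _.
  by exists 0%N => // t; rewrite mul1r.
by exists 1%N => // t; rewrite mulN1r; case: t; apply/val_inj.
Qed.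

Lemma trit_of_ZE z : trit_val (trit_of_Z z) = (int_of_Z z)%:~R.
Proof.
rewrite {2}(Z.div_mod z 3) // rmorphD rmorphM /= rmorphD rmorphM /=.
have -> : (int_of_Z 3)%:~R = 0 :> 'Z_3 by apply/val_inj.
rewrite mul0r add0r /trit_of_Z; have := Z.mod_pos_bound z 3 erefl.
case: (Z.modulo z 3) => [|[p|p|]|p] h; [apply/val_inj => // | exfalso; lia | | apply/val_inj => // | exfalso; lia].
by rewrite (_ : p = xH); [apply/val_inj | lia].
Qed.

(** The prefix condition of the cycle lemma. Its instance at 0 makes the first block vanish. *)
Definition ballot (w : seq nat) : bool := all (fun j => (sumn (take j.+1 w) <= j)%N) (iota 0 (size w)).

Fixpoint weight_lists (l b : nat) : seq (seq nat) :=
  if l is l'.+1 then flatten [seq [seq x :: w | w <- weight_lists l' (b - x)] | x <- iota 0 b.+1]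
  else [:: [::]].

Lemma mem_weight_lists l b w : size w = l -> (sumn w <= b)%N -> w \in weight_lists l b.
Proof.
elim: w l b => [|x w IH] [|l] b // [sw] h; apply/flatten_mapP; exists x.
  by rewrite mem_iota add0n ltnS (leq_trans _ h) //= leq_addr.
by apply: map_f; apply: IH => //; rewrite leq_subRL ?(leq_trans _ h) //= leq_addr.
Qed.

(* The cycle lemma, checked on all cases. *)
Lemma rot_ballot w : size w = 7%N -> (sumn w <= 6)%N -> exists r, ballot (rot r w).
Proof.
move=> sw h; have : all (fun w => has (fun r => ballot (rot r w)) (iota 0 7)) (weight_lists 7 6).
  by vm_compute.
by move/allP/(_ w (mem_weight_lists sw h))/hasP => [r _ br]; exists r.
Qed.

(** Here [u] coefficients have been spent and [n] remain. The count in the hypothesis includes the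
    entry at [i] itself, so just before that entry is spent at least n0 + 1 - (p + i) / 4 remain. *)
Lemma within_levels n0 (c : seq 'Z_3) p u n :
  (u + n = n0)%N ->
  (forall i, (i < size c)%N -> nth 0 c i != 0 ->
     (u + count (predC1 (0%R : 'Z_3)) (take i.+1 c) <= (p + i) %/ 4)%N) ->
  (u + count (predC1 (0%R : 'Z_3)) c <= n0)%N ->
  within [seq (n0.+1 - i %/ 4)%N | i <- iota p (size c)] c n.
Proof.
elim: c p u n => //= x c IH p u n un H le.
have Hs i : (i < size c)%N -> nth 0 c i != 0 ->
     (u + (x != 0%R) + count (predC1 (0%R : 'Z_3)) (take i.+1 c) <= (p.+1 + i) %/ 4)%N.
  by move=> ic ci; rewrite -addnA addSnnS; apply: (H i.+1).
have [x0|x0] := eqVneq x 0.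
  rewrite x0 eqxx /= add0n in Hs le.
  by apply: (IH _ u) => // i ic ci; have := Hs i ic ci; rewrite addn0.
rewrite x0 in Hs le.
have H0 : (u + 1 <= p %/ 4)%N.
  by have := H 0%N (ltn0Sn _) x0; rewrite take0 /= x0 addn0 addn0.
have n0' : (0 < n)%N.
  by rewrite -un in le; lia.
rewrite n0' (_ : (n0.+1 - p %/ 4 <= n)%N); last by rewrite -un; lia.
by apply: (IH _ (u + 1)%N); [lia | exact: Hs | rewrite -addnA].
Qed.

Definition mull (n : nat) (A B : seq (seq Z)) : seq (seq Z) := mulT A (trl n B).

Lemma shape_trl m n A : size A = m -> shape n m (trl n A).
Proof.
move=> sA; rewrite /shape size_map size_iota eqxx /=.
by apply/allP => r /mapP[j _ ->]; rewrite size_map sA.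
Qed.

Lemma mxl_mull m n p A B : shape m n A -> shape n p B ->
  mxl m p (mull p A B) = mxl m n A *m mxl n p B.
Proof.
move=> sA sB; have [zB _] := shapeP sB.
by rewrite /mull -(mxl_mulT sA (shape_trl p zB)) (mxl_trl sB) trmxK.
Qed.

(** * Monomial symmetries: the shift of the seven blocks and the quaternion units *)

Definition monol (f : nat -> nat) (e : nat -> Z) : seq (seq Z) :=
  [seq [seq if (i == f j)%N then e j else 0%coqZ | j <- iota 0 28] | i <- iota 0 28].

Definition shiftl : seq (seq Z) := monol (fun j => (j + 4) %% 28)%N (fun=> 1%coqZ).

(* Left multiplication of each quaternion block by the conjugate of the t-th unit, so that
   the t-th coordinate moves to the real part without change of sign. *)
Definition unit_perm (t : nat) : seq nat :=
  nth [::] [:: [:: 0; 1; 2; 3]; [:: 1; 0; 3; 2]; [:: 2; 3; 0; 1]; [:: 3; 2; 1; 0]]%N t.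
Definition unit_sign (t : nat) : seq Z :=
  nth [::] [:: [:: 1; 1; 1; 1]; [:: 1; -1; 1; -1]; [:: 1; -1; -1; 1]; [:: 1; 1; -1; -1]]%coqZ t.
Definition unit_fun (t j : nat) : nat := (4 * (j %/ 4) + nth 0 (unit_perm t) (j %% 4))%N.
Definition unitl (t : nat) : seq (seq Z) :=
  monol (unit_fun t) (fun j => nth 0%coqZ (unit_sign t) (j %% 4)%N).

Definition at_ (a : 'rV['Z_3]_28) (i : nat) : 'Z_3 := a ord0 (inord i).
Definition nzat (a : 'rV['Z_3]_28) (i : nat) : nat := (at_ a i != 0%R).

Lemma enum_at (a : 'rV['Z_3]_28) : [seq a ord0 i | i <- enum 'I_28] = [seq at_ a i | i <- iota 0 28].
Proof.
by rewrite -val_enum_ord -map_comp; apply: eq_map => i; rewrite /= /at_ inord_val.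
Qed.

Lemma wt_nzat (a : 'rV['Z_3]_28) : wt a = sumn [seq nzat a i | i <- iota 0 28].
Proof.
by rewrite -count_rV enum_at count_map -sumn_count; congr sumn; apply: eq_map.
Qed.

Lemma at_monol f e (a : 'rV['Z_3]_28) j : (j < 28)%N -> (f j < 28)%N ->
  at_ (a *m map_mx intr (mxl 28 28 (monol f e))) j = at_ a (f j) * (int_of_Z (e j))%:~R.
Proof.
move=> j28 fj; rewrite /at_ !mxE (bigD1 (inord (f j))) //= big1 => [|i ne].
  rewrite addr0 !mxE (nth_map 0%N) ?size_iota ?inordK // (nth_map 0%N) ?size_iota //.
  by rewrite !nth_iota // !add0n eqxx.
rewrite !mxE (nth_map 0%N) ?size_iota // (nth_map 0%N) ?size_iota ?inordK //.
rewrite !nth_iota // !add0n; case: eqP => [e0|_]; last by rewrite mulr0.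
by case/eqP: ne; apply: val_inj; rewrite /= inordK.
Qed.

Definition monomial (f : nat -> nat) (e : nat -> Z) : bool :=
  perm_eq [seq f j | j <- iota 0 28] (iota 0 28) &&
  all (fun j => Z.eqb (Z.mul (e j) (e j)) 1) (iota 0 28).

Lemma monomial_lt f e j : monomial f e -> (j < 28)%N -> (f j < 28)%N.
Proof.
move=> /andP[/perm_mem h _] j28; have := h (f j).
by rewrite [RHS]mem_iota leq0n add0n andTb => <-; apply: map_f; rewrite mem_iota leq0n add0n.
Qed.

Lemma nzat_monol f e a j : monomial f e -> (j < 28)%N ->
  nzat (a *m map_mx intr (mxl 28 28 (monol f e))) j = nzat a (f j).
Proof.
move=> mf j28; rewrite /nzat at_monol ?(monomial_lt mf) //; congr nat_of_bool; congr negb.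
case/andP: mf => _ /allP/(_ j); rewrite mem_iota /= j28 => /(_ isT)/Z.eqb_spec ee.
apply/eqP/eqP => [h|->]; last by rewrite mul0r.
have : at_ a (f j) * (int_of_Z (e j))%:~R * (int_of_Z (e j))%:~R = 0 by rewrite h mul0r.
have {}ee : e j * e j = 1 := ee.
by rewrite -mulrA -rmorphM -rmorphM ee !rmorph1 mulr1.
Qed.

Lemma wt_monol f e (a : 'rV['Z_3]_28) : monomial f e -> wt (a *m map_mx intr (mxl 28 28 (monol f e))) = wt a.
Proof.
move=> mf; rewrite !wt_nzat.
have -> : [seq nzat (a *m map_mx intr (mxl 28 28 (monol f e))) i | i <- iota 0 28]
        = map (nzat a) (map f (iota 0 28)).
  by rewrite -map_comp; apply/eq_in_map => j; rewrite mem_iota => /andP[_ j28]; apply: nzat_monol.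
by apply/perm_sumn/perm_map; case/andP: mf.
Qed.

Definition block_wt (W : nat -> nat) (s : nat) : nat :=
  (W (4 * s) + W (4 * s + 1) + W (4 * s + 2) + W (4 * s + 3))%N.

Lemma sumn_blocks W t :
  sumn [seq W i | i <- iota 0 (4 * t)] = sumn [seq block_wt W s | s <- iota 0 t].
Proof.
elim: t => [|t IH] //; rewrite mulnS addnC iotaD map_cat sumn_cat IH.
rewrite -[in RHS](addn1 t) iotaD map_cat sumn_cat.
by rewrite /= /block_wt !add0n !addn0 addn1 addn2 addn3 !addnA.
Qed.

Lemma ballot_prefix W i : ballot [seq block_wt W s | s <- iota 0 7] -> (i < 28)%N ->
  (sumn [seq W j | j <- iota 0 i.+1] <= i %/ 4)%N.
Proof.
move=> /allP/(_ (i %/ 4)%N); rewrite size_map size_iota mem_iota leq0n add0n andTb => H i28.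
have i7 : (i %/ 4 < 7)%N by rewrite ltn_divLR.
apply: leq_trans (H i7); rewrite -map_take take_iota (minn_idPl _) // -sumn_blocks.
have le : (i.+1 <= 4 * (i %/ 4).+1)%N by rewrite mulnC -ltn_divLR.
by rewrite -(subnKC le) iotaD map_cat sumn_cat leq_addr.
Qed.

Definition blocks (a : 'rV['Z_3]_28) : seq nat := [seq block_wt (nzat a) s | s <- iota 0 7].

Lemma sumn_blocks_wt a : sumn (blocks a) = wt a.
Proof. by rewrite wt_nzat -(sumn_blocks _ 7). Qed.

Lemma monomial_shift : monomial (fun j => (j + 4) %% 28)%N (fun=> 1%coqZ).
Proof. by vm_compute. Qed.

Lemma monomial_unit t : (t < 4)%N ->
  monomial (unit_fun t) (fun j => nth 0%coqZ (unit_sign t) (j %% 4)%N).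
Proof. by case: t => [|[|[|[|//]]]] _; vm_compute. Qed.

Lemma blocks_shift a : blocks (a *m map_mx intr (mxl 28 28 shiftl)) = rot 1 (blocks a).
Proof.
have H j (j28 : (j < 28)%N) := nzat_monol a monomial_shift j28.
by rewrite /blocks /= /block_wt /shiftl !H.
Qed.

Lemma blocks_unit t a : (t < 4)%N -> blocks (a *m map_mx intr (mxl 28 28 (unitl t))) = blocks a.
Proof.
move=> t4; have H j (j28 : (j < 28)%N) := nzat_monol a (monomial_unit t4) j28.
apply/eq_in_map => s; rewrite mem_iota => /andP[_ s7].
rewrite /block_wt /unitl !H; try lia.
have E i : (i < 4)%N -> unit_fun t (4 * s + i) = (4 * s + nth 0 (unit_perm t) i)%N.
  move=> i4; rewrite /unit_fun [(4 * s)%N]mulnC divnMDl // modnMDl (divn_small i4) (modn_small i4).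
  by rewrite addn0 mulnC.
have := E 0%N isT; rewrite addn0 => ->; rewrite !E //.
by case: t t4 {H E} => [|[|[|[|//]]]] _ /=; rewrite addn0; lia.
Qed.

Section TernaryMin.
Variable l : seq (seq Z).
Hypothesis sl : shape 28 28 l.
Hypothesis comm_shift : mull 28 shiftl l = mull 28 l shiftl.
Hypothesis comm_unit : forall t, (t < 4)%N -> mull 28 (unitl t) l = mull 28 l (unitl t).

Let M : 'M['Z_3]_28 := map_mx intr (mxl 28 28 l).

Definition same_wt (a b : 'rV['Z_3]_28) : Prop := wt b = wt a /\ wt (b *m M) = wt (a *m M).

Lemma same_wt_trans a b c : same_wt a b -> same_wt b c -> same_wt a c.
Proof. by move=> [h1 h2] [h3 h4]; split; rewrite ?h3 ?h4. Qed.

Lemma shape_monol f e : shape 28 28 (monol f e).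
Proof.
rewrite /shape /monol size_map size_iota eqxx andTb.
by apply/allP => r /mapP[i _ ->]; rewrite size_map size_iota.
Qed.

Lemma same_wt_monol f e a : monomial f e -> mull 28 (monol f e) l = mull 28 l (monol f e) ->
  same_wt a (a *m map_mx intr (mxl 28 28 (monol f e))).
Proof.
move=> mf cm; have sm := shape_monol f e.
split; rewrite ?wt_monol // -mulmxA -map_mxM -(mxl_mull sm sl) cm (mxl_mull sl sm) map_mxM.
by rewrite mulmxA wt_monol.
Qed.

Lemma same_wt_scale x a : x != 0 -> same_wt a (x *: a).
Proof.
have [->|->|->] := Z3_cases x; rewrite ?eqxx // => _; first by rewrite scale1r.
by rewrite scaleN1r; split; rewrite ?mulNmx wt_opp.
Qed.

Lemma same_wt_rot r a : exists2 b, same_wt a b & blocks b = rot r (blocks a).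
Proof.
elim: r => [|r [b ab eb]]; first by exists a; rewrite ?rot0.
have [r7|r7] := ltnP r 7; last first.
  by exists a => //; rewrite rot_oversize // size_map size_iota ltnW.
exists (b *m map_mx intr (mxl 28 28 shiftl)).
  exact: same_wt_trans ab (same_wt_monol _ monomial_shift comm_shift).
by rewrite blocks_shift eb [RHS]rotS.
Qed.

(** Weight at most 6 over 7 blocks lets the cycle lemma choose a rotation with the ballot property.
    Its first block is zero, so the first nonzero block [s] is positive; a quaternion unit brings a
    nonzero entry to the front of that block, and a sign makes it 1. None of these moves changes the
    weight of either half. *)
Lemma canonical_word a : a != 0 -> (wt a <= 6)%N -> exists c s,
  [/\ same_wt a c, (0 < s < 7)%N, (forall i, (i < 4 * s)%N -> at_ c i = 0),
      at_ c (4 * s) = 1 & ballot (blocks c)].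
Proof.
move=> a0 wa; have [r br] : exists r, ballot (rot r (blocks a)).
  by apply: rot_ballot; rewrite ?size_map ?size_iota // sumn_blocks_wt.
have [b ab eb] := same_wt_rot r a; rewrite -eb in br.
have wb : (0 < sumn (blocks b))%N by rewrite sumn_blocks_wt ab.1 lt0n wt_eq0.
have hb : has (leq 1) (blocks b).
  move: wb; apply: contraLR => /hasPn h; rewrite -eqn0Ngt; apply/eqP.
  by elim: (blocks b) h => //= x w IH h; rewrite IH => [|y yw]; [have := h x; rewrite inE eqxx lt0n negbK addn0 => /(_ isT)/eqP | apply: h; rewrite inE yw orbT].
set s := find (leq 1) (blocks b).
have s7 : (s < 7)%N by rewrite -[7%N](size_iota 0) -(size_map (block_wt (nzat b))) -has_find.
have bs : (0 < block_wt (nzat b) s)%N.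
  by have := nth_find 0%N hb; rewrite -/s (nth_map 0%N) ?size_iota // nth_iota.
have bl i : (i < s)%N -> block_wt (nzat b) i = 0%N.
  move=> si; have := before_find 0%N si; rewrite (nth_map 0%N) ?size_iota ?(ltn_trans si) //.
  by rewrite nth_iota ?(ltn_trans si) // add0n; case: (block_wt _ _).
have s0 : (0 < s)%N.
  rewrite lt0n; apply: contraTneq br => s0; apply/negP => /allP/(_ 0%N isT) /=.
  by move: bs; rewrite s0 addn0; case: (block_wt _ _).
have [t t4 bt] : exists2 t, (t < 4)%N & at_ b (4 * s + t) != 0.
  case: (boolP (at_ b (4 * s + 0) != 0)) => h0; first by exists 0%N.
  case: (boolP (at_ b (4 * s + 1) != 0)) => h1; first by exists 1%N.
  case: (boolP (at_ b (4 * s + 2) != 0)) => h2; first by exists 2%N.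
  case: (boolP (at_ b (4 * s + 3) != 0)) => h3; first by exists 3%N.
  by move: bs h0 h1 h2 h3; rewrite /block_wt /nzat addn0; do 4!case: (_ != _).
pose b' := b *m map_mx intr (mxl 28 28 (unitl t)).
have eb' : blocks b' = blocks b by apply: blocks_unit.
pose x := at_ b' (4 * s).
have ex : x = at_ b (4 * s + t).
  rewrite /x /b' /unitl at_monol; last 2 first.
  - by clear -s7; lia.
  - by apply: (monomial_lt (monomial_unit t4)); clear -s7; lia.
  rewrite /unit_fun mulKn // modnMr.
  by case: t t4 {bt b' eb' x} => [|[|[|[|//]]]] _ /=; rewrite mulr1.
have x0 : x != 0 by rewrite ex.
have nzc i : nzat (x *: b') i = nzat b' i.
  by rewrite /nzat /at_ mxE; have [h|h|h] := Z3_cases x; rewrite h ?mul1r ?mulN1r ?oppr_eq0 // h eqxx in x0 *.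
have ec : blocks (x *: b') = blocks b.
  rewrite -eb'; apply: eq_map => i; by rewrite /block_wt !nzc.
exists (x *: b'), s; split; rewrite ?ec ?s0 //.
- apply: same_wt_trans ab _; apply: same_wt_trans (same_wt_scale _ x0).
  exact: same_wt_monol (monomial_unit t4) (comm_unit t4).
- move=> i i4; have i7 : (i %/ 4 < s)%N by rewrite ltn_divLR // mulnC.
  have := bl _ i7.
  have -> : block_wt (nzat b) (i %/ 4) = block_wt (nzat (x *: b')) (i %/ 4).
    have := congr1 (nth 0%N ^~ (i %/ 4)%N) ec.
    rewrite !(nth_map 0%N) ?size_iota ?(ltn_trans i7) //.
    by rewrite !nth_iota ?(ltn_trans i7) // add0n.
  rewrite /block_wt => h; have : nzat (x *: b') i = 0%N.
    rewrite (divn_eq i 4) mulnC; move: (i %/ 4)%N h (i %% 4)%N (@ltn_pmod i 4 isT) => q h.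
    by clear -h; case=> [|[|[|[|//]]]] _; rewrite ?addn0; lia.
  by rewrite /nzat; case: eqP.
- by rewrite /at_ mxE -/(at_ b' (4 * s)) -/x; have [h|h|h] := Z3_cases x; rewrite h ?mulr1 ?mulrNN ?mulr1 // h eqxx in x0 *.
Qed.

Let rows := map (map trit_of_Z) l.

(* In a canonical word at most [i %/ 4] nonzero entries lie in positions up to [i], so the budget is at
   least [n0.+1 - i %/ 4] when generator [i] is used. *)
Definition tern_light_free (n0 : nat) : bool :=
  all (fun s => let r := nth [::] rows (4 * s) in
    heavy trit_nz (n0.-1 + (12 - n0))%N r &&
    light_free trit_nz trit_add (fun n => n + (12 - n0))%N
      (zip [seq (n0.+1 - i %/ 4)%N | i <- iota (4 * s).+1 (27 - 4 * s)]
           (map (multiples [:: id; trit_neg]) (drop (4 * s).+1 rows))) n0.-1 r) (iota 1 6).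

(** The leading 1 of a canonical word spends one unit, so the enumeration starts at row [4 * s] with
    budget [n0.-1]. With u further nonzero entries the image has weight above (n0 - 1 - u) + (12 -
    n0) = 11 - u, and the total exceeds 12. *)
Lemma ternary_min n0 a : (n0 <= 6)%N -> tern_light_free n0 -> a != 0 -> (wt a <= n0)%N ->
  (12 < wt a + wt (a *m M))%N.
Proof.
move=> n06 /allP lf a0 wa.
have [c [s [[wc wcM] s17 c0 c1 bc]]] := canonical_word a0 (leq_trans wa n06).
rewrite -wc -wcM; rewrite -wc in wa.
have [s0 s7] := andP s17.
have /lf/andP[hv {}lf] : s \in iota 1 6 by rewrite mem_iota.
have [szl szr] := shapeP sl.
have szR : size rows = 28%N by rewrite size_map.
have s4 : (4 * s < 28)%N by clear -s7; lia.
set c' := [seq at_ c i | i <- iota (4 * s).+1 (27 - 4 * s)].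
have szc' : size c' = (27 - 4 * s)%N by rewrite size_map size_iota.
have e28 : 28%N = (4 * s + (27 - 4 * s).+1)%N by clear -s7; lia.
have ecl : [seq c ord0 i | i <- enum 'I_28] =
    [seq at_ c i | i <- iota 0 (4 * s)] ++ 1 :: c'.
  by rewrite enum_at {1}e28 iotaD map_cat /= add0n c1.
have z0 : all (pred1 (0 : 'Z_3)) [seq at_ c i | i <- iota 0 (4 * s)].
  by apply/allP => x /mapP[i]; rewrite mem_iota add0n => /andP[_ i4] ->; rewrite /= c0.
have cnt0 : count (predC1 (0%R : 'Z_3)) [seq at_ c i | i <- iota 0 (4 * s)] = 0%N.
  by apply/eqP; rewrite -leqn0 leqNgt -has_count has_predC z0.
have wcE : wt c = (1 + count (predC1 (0%R : 'Z_3)) c')%N.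
  by rewrite -count_rV ecl count_cat cnt0.
have ecM : c *m M = rowv trit_val T0 28 (nth [::] rows (4 * s)) +
    \sum_(p <- zip c' (drop (4 * s).+1 rows)) p.1 *: rowv trit_val T0 28 p.2.
  rewrite /M (mulmx_zip trit_of_ZE c sl (erefl T0)) ecl -/rows.
  rewrite -[in LHS](cat_take_drop (4 * s) rows) (drop_nth [::]) ?szR //.
  rewrite zip_cat ?size_map ?size_iota ?size_takel ?szR ?(ltnW s4) // big_cat /=.
  by rewrite (zip_all0 _ _ _ _ z0) add0r big_cons scale1r.
have szr4 : size (nth [::] rows (4 * s)) = 28%N by rewrite (nth_map [::]) ?szl // size_map szr.
rewrite wcE ecM.
case hc: (has (predC1 (0 : 'Z_3)) c'); last first.
  have cz : all (pred1 (0 : 'Z_3)) c' by rewrite has_predC in hc; move/negbFE: hc.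
  rewrite (zip_all0 _ _ _ _ cz) addr0 (wt_rowv _ trit_nzE szr4).
  by have := heavy_count hv; move: wa; rewrite wcE; clear -n06; lia.
have := @light_freeP _ trit_nz trit_add _ trit_val [:: id; trit_neg] T0 trit_nzE trit_addE trit_unitsP
   _ 28 _ _ _ _ c' _ _ szr4 _ lf _ hc.
set X := wt _; rewrite size_map size_iota size_drop szR => H.
have {H} : ((fun n => n + (12 - n0)) (n0.-1 - count (predC1 (0%R : 'Z_3)) c') < X)%N.
  apply: H; rewrite ?szc' //.
  - rewrite -map_drop all_map; apply/allP => r /mem_drop rl /=; rewrite size_map.
    by case/andP: sl => _ /allP/(_ r rl).
  rewrite -szc'; apply: (@within_levels n0 _ _ 1).
  - by move: wa; rewrite wcE; clear; lia.
  - move=> i ic _; have := ballot_prefix (i := ((4 * s).+1 + i)%N) bc.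
    have -> : [seq nzat c j | j <- iota 0 ((4 * s).+1 + i).+1]
         = map (fun x : 'Z_3 => nat_of_bool (x != 0)) ([seq at_ c i | i <- iota 0 (4 * s)] ++ 1 :: take i.+1 c').
      rewrite -map_take take_iota (minn_idPl _); last by rewrite -szc'.
      by rewrite -c1 -[_ :: _]/([seq at_ c i | i <- iota (4 * s) i.+2]) -map_cat -map_comp -[X in iota X _]add0n -iotaD addSn -addnS -addnS.
    rewrite sumn_count count_cat cnt0 /=; apply; rewrite szc' in ic; clear -ic s7; lia.
  - by rewrite -wcE.
by move: wa; rewrite wcE; clear -n06; lia.
Qed.

End TernaryMin.

(** * An even unimodular lattice and its frames *)

Section Dotr.
Variable n : nat.
Implicit Types x y z : 'rV[int]_n.

Lemma dotrC x y : dotr x y = dotr y x.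
Proof. by apply: eq_bigr => i _; rewrite mulrC. Qed.

Lemma dotrDl x y z : dotr (x + y) z = dotr x z + dotr y z.
Proof. by rewrite /dotr -big_split; apply: eq_bigr => i _; rewrite mxE mulrDl. Qed.

Lemma dotrDr x y z : dotr x (y + z) = dotr x y + dotr x z.
Proof. by rewrite dotrC dotrDl !(dotrC x). Qed.

Lemma dotrZl a x y : dotr (a *: x) y = a * dotr x y.
Proof. by rewrite /dotr mulr_sumr; apply: eq_bigr => i _; rewrite mxE mulrA. Qed.

Lemma dotrZr a x y : dotr x (a *: y) = a * dotr x y.
Proof. by rewrite dotrC dotrZl dotrC. Qed.

Lemma dotr_delta x j : dotr x (delta_mx ord0 j) = x ord0 j.
Proof.
rewrite /dotr (bigD1 j) //= mxE !eqxx mulr1 big1 ?addr0 // => i ij.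
by rewrite mxE (negPf ij) andbF mulr0.
Qed.

Lemma dotr_mulmx x (A : 'M[int]_n) y : dotr (x *m A) y = dotr x (y *m A^T).
Proof. by rewrite !dotrE trmx_mul trmxK mulmxA. Qed.

Lemma dotr_ge0 x : 0 <= dotr x x.
Proof. by apply: sumr_ge0 => i _; rewrite -expr2 sqr_ge0. Qed.

Lemma dotr_eq0 x : dotr x x = 0 -> x = 0.
Proof.
move/eqP; rewrite /dotr psumr_eq0 => [|i _]; last by rewrite -expr2 sqr_ge0.
by move/allP => h; apply/rowP => i; have := h i (mem_index_enum i); rewrite mulf_eq0 orbb mxE => /eqP.
Qed.

Lemma sqr_parity (a : int) : (2 %| a ^+ 2 - a)%Z.
Proof.
have [q [->|->]] := mod2_cases a; apply/dvdzP; [exists (2 * q ^+ 2 - q) | exists (2 * q ^+ 2 + q)];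
  by ring.
Qed.

(* [dotr 1 x] is the coordinate sum of [x]. *)
Lemma dotr_parity x : (2 %| dotr x x - dotr (const_mx 1) x)%Z.
Proof.
rewrite /dotr -sumrB; apply: (big_ind (fun s => (2 %| s)%Z)) => [||i _].
- exact: dvdz0.
- exact: rpredD.
- by rewrite mxE mul1r -expr2 sqr_parity.
Qed.

End Dotr.

Lemma mulmx_tr_dotr m n (x : 'rV[int]_n) (A : 'M[int]_(m, n)) i :
  (x *m A^T) ord0 i = dotr x (row i A).
Proof. by rewrite /dotr mxE; apply: eq_bigr => j _; rewrite !mxE. Qed.

Lemma dotr_row_mx n1 n2 (a c : 'rV[int]_n1) (b d : 'rV[int]_n2) :
  dotr (row_mx a b) (row_mx c d) = dotr a c + dotr b d.
Proof.
by rewrite /dotr big_split_ord /=; congr (_ + _); apply: eq_bigr => i _; rewrite ?row_mxEl ?row_mxEr.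
Qed.

Section Lattice.
Variables (h : nat) (M : 'M[int]_h) (q : int).
Local Notation n := (h + h)%N.
Hypothesis n8 : (8 %| n)%N.
Hypothesis n48 : (48 < n)%N.
Hypothesis MMt : M *m M^T = (3 * q - 1)%:M.
Hypothesis Mmin : forall a : 'rV['Z_3]_h, a != 0 -> (12 < wt a + wt (a *m map_mx intr M))%N.

Let MtM : M^T *m M = (3 * q - 1)%:M.
Proof. by apply: scalar_mul_comm MMt; clear; lia. Qed.

(** Vanishes mod 3 exactly when [y] reduces to a word (a, a M) of the ternary code. *)
Definition defect (y : 'rV[int]_n) : 'rV[int]_h := rsubmx y - lsubmx y *m M.

Lemma defectD x y : defect (x + y) = defect x + defect y.
Proof. by rewrite /defect !linearD /= mulmxDl opprD addrACA. Qed.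

Lemma defectZ a x : defect (a *: x) = a *: defect x.
Proof. by rewrite /defect !linearZ /= -scalemxAl scalerBr. Qed.

(* Scaled by 2 sqrt 3, so that norms are multiples of 24 and the minimum norm 6 becomes 72: the even
   unimodular neighbour of the construction A lattice of the ternary code (1, M). *)
Definition in_lattice (y : 'rV[int]_n) : bool :=
  [&& [forall i, forall j, (2 %| y ord0 i - y ord0 j)%Z], (4 %| dotr (const_mx 1) y)%Z &
      dvdmx 3 (defect y)].

(** The ternary code is self-orthogonal because 1 + M M^T = 3q. *)
Lemma dvd3_dotr x y : dvdmx 3 (defect x) -> dvdmx 3 (defect y) -> (3 %| dotr x y)%Z.
Proof.
move=> /dvdmxP[u eu] /dvdmxP[v ev].
have E z w : defect z = 3 *: w -> z = row_mx (lsubmx z) (lsubmx z *m M + 3 *: w).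
  by move=> <-; rewrite /defect addrC subrK hsubmxK.
rewrite (E _ _ eu) (E _ _ ev) dotr_row_mx dotrDl !dotrDr !dotrZl !dotrZr.
rewrite dotr_mulmx -mulmxA MMt mul_mx_scalar dotrZr.
set s := dotr (lsubmx x) _; set a := dotr _ v; set b := dotr u _; set c := dotr u v.
by apply/dvdzP; exists (q * s + a + b + 3 * c); ring.
Qed.

Lemma parity_split (y : 'rV[int]_n) : [forall i, forall j, (2 %| y ord0 i - y ord0 j)%Z] ->
  exists (p : int) z, y = p *: const_mx 1 + 2 *: z /\ (p = 0 \/ p = 1).
Proof.
move=> /forallP H; have n0 : (0 < n)%N by clear -n48; lia.
have [r e0] := mod2_cases (y ord0 (Ordinal n0)).
have [p [p01 ep]] : exists p : int, (p = 0 \/ p = 1) /\ y ord0 (Ordinal n0) = 2 * r + p.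
  by case: e0 => e; [exists 0; rewrite e addr0; split; [left|] | exists 1; split; [right|]].
exists p, (\row_i ((y ord0 i - p) %/ 2)%Z); split=> //.
apply/rowP => i; rewrite !mxE mulr1 [2 * _]mulrC divzK ?[p + _]addrC ?subrK //.
have /forallP/(_ (Ordinal n0)) := H i; rewrite ep => /dvdzP[t et].
by apply/dvdzP; exists (t + r); move: et; clear; lia.
Qed.

Lemma sum_const : dotr (const_mx 1 : 'rV[int]_n) (const_mx 1) = n%:Z.
Proof.
rewrite /dotr (eq_bigr (fun=> 1)) => [|i _]; last by rewrite !mxE mulr1.
by rewrite sumr_const card_ord natz.
Qed.

Lemma sum_const8 : exists m : int, dotr (const_mx 1 : 'rV[int]_n) (const_mx 1) = m * 8.
Proof. by case/dvdnP: n8 => m e; exists m; rewrite sum_const -PoszM -e. Qed.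

(** The coordinate sum p n + 2 (1.z) is divisible by 4, and 8 divides n, so 1.z is even. *)
Lemma lattice_split y : in_lattice y -> exists (p : int) z,
  [/\ y = p *: const_mx 1 + 2 *: z, p = 0 \/ p = 1 & (2 %| dotr (const_mx 1) z)%Z].
Proof.
move=> /and3P[/parity_split[p [z [ey p01]]] s4 _]; exists p, z; split=> //.
have [m em] := sum_const8; move: s4; rewrite ey dotrDr !dotrZr em => /dvdzP[t et].
apply/dvdzP; exists (t - 2 * p * m); move: et; clear.
move: (dotr _ _) => u et; apply: (@mulfI _ 2) => //; move: et => /(canRL (addKr _)) ->; ring.
Qed.

Lemma lattice_dotr x y : in_lattice x -> in_lattice y -> (12 %| dotr x y)%Z.
Proof.
move=> Lx Ly; rewrite (_ : 12 = 3 * 4) // Gauss_dvdz //; apply/andP; split.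
  by case/and3P: Lx Ly => _ _ dx /and3P[_ _ dy]; apply: dvd3_dotr.
have [p [x' [-> _ /dvdzP[s es]]]] := lattice_split Lx.
have [r [y' [-> _ /dvdzP[t et]]]] := lattice_split Ly.
have [m em] := sum_const8; rewrite dotrDl !dotrDr !dotrZl !dotrZr em et [dotr x' _]dotrC es.
by apply/dvdzP; exists (2 * p * r * m + p * t + r * s + dotr x' y'); ring.
Qed.

(** Modulo 8 all of p^2 n, 4p (1.z) and 4 z.z vanish, since z.z has the parity of the even number
    1.z. *)
Lemma lattice_norm y : in_lattice y -> (24 %| dotr y y)%Z.
Proof.
move=> Ly; rewrite (_ : 24 = 3 * 8) // Gauss_dvdz //; apply/andP; split.
  by case/and3P: Ly => _ _ dy; apply: dvd3_dotr.
have [p [z [-> _ /dvdzP[s es]]]] := lattice_split Ly.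
have /dvdzP[t et] := dotr_parity z; rewrite es in et.
have {}et : dotr z z = 2 * (t + s) by move: et; clear; move: (dotr z z) => u; lia.
have [m em] := sum_const8.
rewrite dotrDl !dotrDr !dotrZl !dotrZr em [dotr z (const_mx _)]dotrC es et.
by apply/dvdzP; exists (p * p * m + p * s + t + s); ring.
Qed.

(** It suffices to pass 48. If [y] is odd, each square is at least 1 and the norm is at least n >
    48. If y = 2z with z = 3t, then t.t is even and nonzero, so the norm is at least 36 * 2.
    Otherwise [z] reduces to a nonzero ternary word of weight at least 13, and 4 * 13 > 48. *)
Lemma lattice_min y : in_lattice y -> y != 0 -> 72 <= dotr y y.
Proof.
move=> Ly y0; apply: (dvdz_leS (lattice_norm Ly)) => //; rewrite (_ : 72 - 24 = 48) //.
have [p [z [ey p01 /dvdzP[s es]]]] := lattice_split Ly.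
case: p01 ey => -> ey; last first.
  apply: (@lt_le_trans _ _ n%:Z); first by rewrite ltz_nat.
  rewrite -sum_const; apply: ler_sum => i _; rewrite ey !mxE mulr1 -expr2.
  by move: (z _ _) => t; clear; rewrite -subr_ge0 (_ : _ - _ = 4 * (t * (t + 1))); [nia | ring].
rewrite scale0r add0r in ey; rewrite ey dotrZl dotrZr.
case: (boolP (dvdmx 3 z)) => [/dvdmxP[t et] | nz].
  have t0 : dotr t t != 0.
    by apply: contraNneq y0 => /dotr_eq0 t0; rewrite ey et t0 !scaler0.
  have /dvdzP[r er] := dotr_parity t.
  rewrite et dotrZr in es; rewrite et dotrZl dotrZr.
  move: (dotr_ge0 t) t0 er es; move: (dotr t t) (dotr _ t) => u v; clear; lia.
have dz : dvdmx 3 (defect z).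
  case/and3P: Ly => _ _; rewrite ey defectZ => /forallP H.
  apply/forallP => i; apply/forallP => j; have /forallP/(_ j) := H i.
  by rewrite mxE Gauss_dvdzr.
pose a : 'rV['Z_3]_h := map_mx intr (lsubmx z).
have ez : map_mx intr z = row_mx a (a *m map_mx intr M).
  have /dvdmxP[v ev] := dz.
  rewrite -[z in LHS]hsubmxK map_row_mx (_ : rsubmx z = lsubmx z *m M + 3 *: v); last first.
    by rewrite -ev /defect addrC subrK.
  by rewrite map_mxD map_mxM map_mxZ /= (_ : 3%:~R = 0) ?scale0r ?addr0 //; apply/val_inj.
have a0 : a != 0.
  by apply: contra nz => /eqP a0; rewrite -(@map_intr_eq0 3) // ez a0 mul0mx row_mx0.
have := Mmin a0; rewrite -wt_row_mx -ez; have := wt_le_dotr 'Z_3 z.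
by move: (dotr z z) (wt _) => u w; clear; lia.
Qed.

Lemma in_latticeD x y : in_lattice x -> in_lattice y -> in_lattice (x + y).
Proof.
move=> /and3P[px sx dx] /and3P[py sy dy]; apply/and3P; split.
- apply/forallP => i; apply/forallP => j; rewrite !mxE opprD addrACA.
  by apply: rpredD; [have /forallP := forallP px i | have /forallP := forallP py i].
- by rewrite dotrDr rpredD.
- have /dvdmxP[u eu] := dx; have /dvdmxP[v ev] := dy; apply/dvdmxP; exists (u + v).
  by rewrite defectD eu ev scalerDr.
Qed.

Lemma in_latticeZ a x : in_lattice x -> in_lattice (a *: x).
Proof.
move=> /and3P[px sx dx]; apply/and3P; split.
- apply/forallP => i; apply/forallP => j; rewrite !mxE -mulrBr.
  by apply: dvdz_mull; have /forallP := forallP px i.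
- by rewrite dotrZr dvdz_mull.
- have /dvdmxP[u eu] := dx; apply/dvdmxP; exists (a *: u).
  by rewrite defectZ eu !scalerA mulrC.
Qed.

Lemma even_in_lattice y : dvdmx 3 (defect y) -> (2 %| dotr (const_mx 1) y)%Z -> in_lattice (2 *: y).
Proof.
move=> /dvdmxP[u eu] /dvdzP[s es]; apply/and3P; split.
- by apply/forallP => i; apply/forallP => j; rewrite !mxE -mulrBr dvdz_mulr.
- by rewrite dotrZr es mulrCA dvdz_mull.
- by apply/dvdmxP; exists (2 *: u); rewrite defectZ eu !scalerA.
Qed.

Lemma dotr_const1_delta (j : 'I_n) : dotr (const_mx 1) (delta_mx ord0 j) = 1 :> int.
Proof. by rewrite dotr_delta mxE. Qed.

(** For distinct [i] and [j] these are minimal vectors, of norm 72. They serve both to cut down the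
    dual lattice and to show that the minimum weight is attained. *)
Lemma glue_in_lattice (i j : 'I_n) a : a = 1 \/ a = -1 ->
  in_lattice (6 *: (delta_mx ord0 i + a *: delta_mx ord0 j)).
Proof.
move=> a1; rewrite (_ : 6 = 2 * 3) // -scalerA; apply: even_in_lattice.
  by rewrite defectZ; apply/dvdmxP; eexists.
by rewrite dotrZr dotrDr dotrZr !dotr_const1_delta; case: a1 => ->.
Qed.

(** Unimodularity, tested on a few lattice vectors. The vectors 6(e_i + e_j) and 6(e_i - e_j) give
    divisibility by [k] and equal parities of the quotients, 3(1,...,1) the coordinate sum mod 4,
    and 4(e_i, M_i) the relation v1 + v2 M^T = 0 mod 3, which becomes the defect condition after
    multiplication by M, as M^T M = -1 mod 3. *)
Lemma lattice_dual (k : int) (x : 'rV[int]_n) : 0 < k ->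
  (forall y, in_lattice y -> (12 * k %| dotr x y)%Z) -> exists2 v, x = k *: v & in_lattice v.
Proof.
move=> k0 H; have kn0 : k != 0 by clear -k0; lia.
have G i j a : a = 1 \/ a = -1 -> (2 * k %| x ord0 i + a * x ord0 j)%Z.
  move=> a1; have := H _ (glue_in_lattice i j a1).
  rewrite dotrZr dotrDr dotrZr !dotr_delta (_ : 12 * k = 6 * (2 * k)); last by ring.
  by rewrite dvdz_mul2l.
have /dvdmxP[v ev] : dvdmx k x.
  apply/forallP => i; apply/forallP => j; rewrite ord1.
  have := G j j 1 (or_introl erefl); rewrite mul1r (_ : x ord0 j + x ord0 j = 2 * x ord0 j); last by ring.
  by rewrite dvdz_mul2l.
exists v => //; rewrite ev in G H.
have Hv y : in_lattice y -> (12 %| dotr v y)%Z.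
  by move=> /H; rewrite dotrZl [12 * k]mulrC dvdz_mul2l.
apply/and3P; split.
- apply/forallP => i; apply/forallP => j; have := G i j (-1) (or_intror erefl).
  by rewrite !mxE mulN1r -mulrBr [2 * k]mulrC dvdz_mul2l.
- rewrite dotrC; have : in_lattice (3 *: const_mx 1).
    apply/and3P; split.
    + by apply/forallP => i; apply/forallP => j; rewrite !mxE subrr.
    + by have [m em] := sum_const8; rewrite dotrZr em; apply/dvdzP; exists (6 * m); ring.
    + by rewrite defectZ; apply/dvdmxP; eexists.
  by move/Hv; rewrite dotrZr (_ : 12 = 3 * 4) // dvdz_mul2l.
have V i : (3 %| (lsubmx v + rsubmx v *m M^T) ord0 i)%Z.
  have L : in_lattice (2 *: (2 *: row_mx (delta_mx ord0 i) (row i M))).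
    apply: even_in_lattice; last by rewrite dotrZr dvdz_mulr.
    rewrite defectZ /defect row_mxKl row_mxKr -rowE subrr scaler0.
    by apply/dvdmxP; exists 0; rewrite scaler0.
  have := Hv _ L; rewrite scalerA dotrZr (_ : 12 = (2 * 2) * 3) // dvdz_mul2l //.
  rewrite -[v in dotr v]hsubmxK dotr_row_mx dotr_delta.
  by rewrite [X in _ -> (_ %| X)%Z]mxE mulmx_tr_dotr.
have /dvdmxP[t et] : dvdmx 3 (lsubmx v + rsubmx v *m M^T).
  by apply/forallP => i; apply/forallP => j; rewrite ord1.
apply/dvdmxP; exists (q *: rsubmx v - t *m M).
rewrite /defect. have -> : lsubmx v = 3 *: t - rsubmx v *m M^T by rewrite -et addrK.
rewrite mulmxBl -mulmxA MtM mul_mx_scalar -scalemxAl opprB addrA scalerBr scalerA.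
by rewrite -{1}[rsubmx v]scale1r -scalerDl (_ : 1 + _ = 3 * q) //; ring.
Qed.

(** * Type II codes from frames of the lattice *)

Section Frame.
Variables (k : nat) (F : 'M[int]_n).
Hypothesis k3 : (2 < k)%N.
(** The frame vectors are the doubled rows of [F]: their norm 24k is 2k after division by the scale
    12. *)
Hypothesis FFt : F *m F^T = (6 * k%:Z)%:M.
Hypothesis F3 : forall c, dvdmx 3 (defect (c *m F)).

Let k_gt0 : (0 < k)%N. Proof. by clear -k3; lia. Qed.
Let kz0 : k%:Z != 0. Proof. by clear -k3; lia. Qed.

Let FtF : F^T *m F = (6 * k%:Z)%:M.
Proof. by apply: scalar_mul_comm FFt; clear -k3; lia. Qed.

(* [c] collects the inner products, up to scale, of the lattice vector [c F / k] with the frame. *)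
Definition frame_code (c : 'rV[int]_n) : bool :=
  dvdmx k (c *m F) && in_lattice (map_mx (fun z => (z %/ k)%Z) (c *m F)).

Lemma frame_codeP c : reflect (exists2 v, c *m F = k%:Z *: v & in_lattice v) (frame_code c).
Proof.
apply: (iffP andP) => [[/dvdmxP[v ev] L] | [v ev L]]; last first.
  split; first by apply/dvdmxP; exists v.
  by rewrite ev (_ : map_mx _ _ = v) //; apply/rowP => i; rewrite !mxE mulKz.
exists v => //; move: L; rewrite ev (_ : map_mx _ _ = v) //.
by apply/rowP => i; rewrite !mxE mulKz.
Qed.

Lemma frame_dotr (c d v w : 'rV[int]_n) :
  c *m F = k%:Z *: v -> d *m F = k%:Z *: w -> k%:Z * dotr v w = 6 * dotr c d.
Proof.
move=> ec ed; apply: (mulfI kz0).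
have : dotr (c *m F) (d *m F) = 6 * k%:Z * dotr c d.
  by rewrite dotr_mulmx -mulmxA FFt mul_mx_scalar dotrZr.
by rewrite ec ed dotrZl dotrZr => ->; ring.
Qed.

(** A row sum has the parity of the norm 6k; this puts the doubled row into the lattice. *)
Lemma frame_row_even i : (2 %| dotr (const_mx 1) (row i F))%Z.
Proof.
have : (2 %| dotr (row i F) (row i F))%Z.
  rewrite (_ : dotr _ _ = (F *m F^T) i i); last first.
    by rewrite /dotr mxE; apply: eq_bigr => j _; rewrite !mxE.
  by rewrite FFt mxE eqxx mulr1n (_ : 6 * k%:Z = 2 * (3 * k%:Z)) ?dvdz_mulr //; ring.
by rewrite -[X in (_ %| X)%Z](subrK (dotr (const_mx 1) (row i F))) rpredDl // dotr_parity.
Qed.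

(** Inner products with rows of [F] are divisible by 3 by self-orthogonality of the ternary code,
    and by 2 because all coordinates of [y] have the same parity and row sums are even. *)
Lemma frame_coords y : in_lattice y -> exists2 c, y *m F^T = 6 *: c & c *m F = k%:Z *: y.
Proof.
move=> Ly; have /dvdmxP[c ec] : dvdmx 6 (y *m F^T).
  apply/forallP => i0; apply/forallP => i; rewrite ord1.
  rewrite mulmx_tr_dotr.
  rewrite (_ : 6 = 3 * 2) // Gauss_dvdz //; apply/andP; split.
    by case/and3P: Ly => _ _ dy; apply: dvd3_dotr => //; rewrite rowE.
  have [p [z [-> _ _]]] := lattice_split Ly.
  rewrite dotrDl !dotrZl; apply: rpredD; last exact: dvdz_mulr.
  by apply: dvdz_mull; apply: frame_row_even.
exists c => //; apply: (@scalemx_inj 6) => //.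
by rewrite scalemxAl -ec -mulmxA FtF mul_mx_scalar scalerA.
Qed.

(** By [frame_dotr] the products 12, 24 and 72 of the lattice become 2k, 4k and 12k for the code,
    and [lattice_dual] gives self-duality. *)
Lemma frame_code_extremal : exists C : {set 'rV['Z_(2 * k)]_n},
  typeII C /\ min_euclid_weight C (12 * k).
Proof.
apply: (@code_of_lattice k n k_gt0 (12 * k) frame_code).
- move=> x y /frame_codeP[v ev Lv] /frame_codeP[w ew Lw]; apply/frame_codeP.
  by exists (v + w); rewrite ?mulmxDl ?ev ?ew ?scalerDr // in_latticeD.
- move=> a x /frame_codeP[v ev Lv]; apply/frame_codeP; exists (a *: v); last exact: in_latticeZ.
  by rewrite -scalemxAl ev !scalerA mulrC.
- move=> x; apply/frame_codeP; exists (2 *: (x *m F)).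
    by rewrite -scalemxAl scalerA PoszM mulrC.
  apply: even_in_lattice => //; rewrite dotrC dotr_mulmx dotrC.
  by apply: rpred_sum => i _; rewrite mulmx_tr_dotr dvdz_mulr // frame_row_even.
- move=> x y /frame_codeP[v ev Lv] /frame_codeP[w ew Lw].
  have /dvdzP[s es] := lattice_dotr Lv Lw; have := frame_dotr ev ew; rewrite es => e.
  apply/dvdzP; exists s; apply: (@mulfI _ 6) => //; rewrite -e PoszM; ring.
- move=> x H; case: (@lattice_dual k (x *m F) k_gt0) => [y Ly|v ev Lv].
    have [c ec cF] := frame_coords Ly.
    have /dvdzP[s es] : ((2 * k)%N %| dotr x c)%Z by apply: H; apply/frame_codeP; exists y.
    by rewrite dotr_mulmx ec dotrZr es; apply/dvdzP; exists s; rewrite PoszM; ring.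
  by apply/frame_codeP; exists v.
- move=> x /frame_codeP[v ev Lv]; have /dvdzP[s es] := lattice_norm Lv.
  have := frame_dotr ev ev; rewrite es => e.
  apply/dvdzP; exists s; apply: (@mulfI _ 6) => //; rewrite -e PoszM; ring.
- move=> x /frame_codeP[v ev Lv] nx; have v0 : v != 0.
    apply: contra nx => /eqP v0; apply/dvdmxP; exists 0.
    rewrite scaler0; apply: (@scalemx_inj (6 * k%:Z)); first by clear -k3; lia.
    by rewrite -mul_mx_scalar -FFt mulmxA ev v0 !scaler0 mul0mx.
  have := lattice_min Lv v0; have := frame_dotr ev ev; move: (dotr v v) (dotr x x) => a b e ha.
  by rewrite -(@ler_pM2l _ 6) // -e PoszM; clear -ha; nia.
(* For the minimum to be attained, some minimal vector must lie outside the span of the frame. Two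
   minimal vectors with product 36 cannot both lie in it, because products within the span are
   multiples of 24k. *)
have n2 : (2 < n)%N by clear -n48; lia.
pose i0 : 'I_n := Ordinal (ltn_trans (isT : (0 < 2)%N) n2).
pose i1 : 'I_n := Ordinal (ltn_trans (isT : (1 < 2)%N) n2).
pose i2 : 'I_n := Ordinal n2.
pose y (i : 'I_n) : 'rV[int]_n := 6 *: (delta_mx ord0 i0 + 1 *: delta_mx ord0 i).
have Ly i : in_lattice (y i) by apply: glue_in_lattice; left.
have yy i j : i0 != i -> i0 != j -> dotr (y i) (y j) = (36 * (1 + (i == j)))%N.
  move=> i0i i0j; rewrite /y !scale1r dotrZl dotrZr dotrDl !dotrDr !dotr_delta !mxE !eqxx /=.
  rewrite [j == i0]eq_sym (negPf i0i) (negPf i0j) [j == i]eq_sym.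
  by case: (i == j).
have [c1 _ e1] := frame_coords (Ly i1); have [c2 _ e2] := frame_coords (Ly i2).
have d1 := frame_dotr e1 e1; have d2 := frame_dotr e2 e2; have d12 := frame_dotr e1 e2.
rewrite !yy // /= in d1 d2 d12.
have N c : k%:Z * (36 * (1 + true))%N = 6 * dotr c c -> dotr c c = (12 * k)%N.
  by move: (dotr c c) => u; clear; lia.
have P i c : c *m F = k%:Z *: y i -> frame_code c by move=> e; apply/frame_codeP; exists (y i).
case: (boolP (dvdmx (2 * k)%N c1)) => [D1|D1]; last by exists c1; split; [apply: P e1 | | exact: N].
case: (boolP (dvdmx (2 * k)%N c2)) => [D2|D2]; last by exists c2; split; [apply: P e2 | | exact: N].
exfalso; have /dvdmxP[a ea] := D1; have /dvdmxP[b eb] := D2.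
move: d12; rewrite ea eb dotrZl dotrZr PoszM; move: (dotr a b) => u e.
have /(mulfI kz0) : k%:Z * 36 = k%:Z * (24 * (k%:Z * u)) by rewrite e; ring.
by move: (k%:Z * u) => w; clear; lia.
Qed.

End Frame.
End Lattice.

(** * Quaternionic frames *)

Definition quat : Type := (Z * Z * Z * Z)%type.

(* Row [t] is the product of the [t]-th unit 1, i, j, k with [q]. *)
Definition quat_rows (q : quat) : seq (seq Z) :=
  let: (a, b, c, d) := q in
  [:: [:: a; b; c; d]; [:: - b; a; - d; c]; [:: - c; d; a; - b]; [:: - d; - c; b; a]]%coqZ.

(* Right multiplication by an element of the quaternion group ring of Z/7. *)
Definition quat_circulant (m : seq quat) : seq (seq Z) :=
  flatten [seq [seq flatten [seq nth [::] (quat_rows q) t | q <- rotr s m] | t <- iota 0 4]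
          | s <- iota 0 7].

(** Elements of the group ring fixed by s -> -s on Z/7; transposing their matrix only conjugates the
    coefficients. *)
Definition palindrome (q0 q1 q2 q3 : quat) : seq quat := [:: q0; q1; q2; q3; q3; q2; q1].

(** The coefficient norms add up to 18 + 2(6 + 4 + 6) = 50, the diagonal of M M^T. *)
Definition tern_M : seq (seq Z) := quat_circulant
  (palindrome (2, 2, -1, 3) (-1, 0, -2, -1) (-1, 1, 1, -1) (-2, -1, 0, 1))%coqZ.

Lemma shape_tern_M : shape 28 28 tern_M. Proof. by vm_compute. Qed.

Local Notation MM := (mxl 28 28 tern_M).

Lemma tern_M_mul : MM *m MM^T = 50%:M.
Proof.
rewrite (mxl_mulT shape_tern_M shape_tern_M).
have -> : mulT tern_M tern_M = scall 28 50%coqZ by vm_compute.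
exact: mxl_scall.
Qed.

Lemma tern_M_shift : mull 28 shiftl tern_M = mull 28 tern_M shiftl. Proof. by vm_compute. Qed.

Lemma tern_M_unit t : (t < 4)%N -> mull 28 (unitl t) tern_M = mull 28 tern_M (unitl t).
Proof. by case: t => [|[|[|[|//]]]] _; vm_compute. Qed.

(** The inverse of M mod 3, because M M^T = 50 = -1; it recovers the first half of a word from the
    second. *)
Definition tern_M' : seq (seq Z) := negl (trl 28 tern_M).

Lemma tern_M'_shift : mull 28 shiftl tern_M' = mull 28 tern_M' shiftl. Proof. by vm_compute. Qed.

Lemma tern_M'_unit t : (t < 4)%N -> mull 28 (unitl t) tern_M' = mull 28 tern_M' (unitl t).
Proof. by case: t => [|[|[|[|//]]]] _; vm_compute. Qed.

(** Budgets 6 and 5 for the two halves suffice: beyond both, the total weight is at least 7 + 6 =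
    13. *)
Lemma tern_M_light : tern_light_free tern_M 6. Proof. by vm_compute. Qed.
Lemma tern_M'_light : tern_light_free tern_M' 5. Proof. by vm_compute. Qed.

Lemma mxl_negl m n l : mxl m n (negl l) = - mxl m n l.
Proof.
apply/matrixP => i j; rewrite !mxE /negl.
have [il|il] := ltnP i (size l); last by rewrite !(@nth_default _ _ _ i) ?size_map // !nth_nil oppr0.
rewrite (nth_map [::]) //.
have [jl|jl] := ltnP j (size (nth [::] l i)); last first.
  by rewrite [nth _ (map _ _) j]nth_default ?size_map // [nth 0 _ j]nth_default.
by rewrite (nth_map 0) // (rmorphN int_of_Z).
Qed.

Lemma tern_code_min (a : 'rV['Z_3]_28) : a != 0 -> (12 < wt a + wt (a *m map_mx intr MM))%N.
Proof.
move=> a0; set b := a *m _.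
(* By self-duality the two halves of a word play symmetric roles. *)
have ab : a = b *m map_mx intr (mxl 28 28 tern_M').
  rewrite mxl_negl (mxl_trl shape_tern_M) map_mxN mulmxN /b -mulmxA -map_mxM tern_M_mul.
  by rewrite map_scalar_mx mul_mx_scalar -scaleNr (_ : - _ = 1) ?scale1r //; apply/val_inj.
have b0 : b != 0 by apply: contraNneq a0 => b0; rewrite ab b0 mul0mx.
have sM' : shape 28 28 tern_M' by vm_compute.
have [wa|wa] := leqP (wt a) 6.
  exact: (ternary_min shape_tern_M tern_M_shift tern_M_unit _ tern_M_light a0 wa).
have [wb|wb] := leqP (wt b) 5; last by move: (wt a) (wt b) wa wb; clear; lia.
have := ternary_min sM' tern_M'_shift tern_M'_unit (isT : (5 <= 6)%N) tern_M'_light b0 wb.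
by rewrite -ab addnC.
Qed.

Local Notation defectM := (@defect 28 MM).

Lemma frame_extremal (k : nat) (F : 'M[int]_(28 + 28)) : (2 < k)%N ->
  F *m F^T = (6 * k%:Z)%:M -> dvdmx 3 (rsubmx F - lsubmx F *m MM) ->
  exists C : {set 'rV['Z_(2 * k)]_56}, extremal_typeII C.
Proof.
move=> k3 FF /dvdmxP[D eD].
have F3 c : dvdmx 3 (defectM (c *m F)).
  apply/dvdmxP; exists (c *m D); rewrite scalemxAr -eD mulmxBr mulmxA /defect.
  by rewrite -[F in LHS]hsubmxK mul_mx_row row_mxKl row_mxKr.
have MMq : MM *m MM^T = (3 * 17 - 1)%:M by rewrite tern_M_mul.
have [C [tC mC]] := frame_code_extremal (isT : (8 %| 28 + 28)%N) (isT : (48 < 28 + 28)%N)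
  MMq tern_code_min k3 FF F3.
exists C; split; first exact: tC.
by rewrite (_ : (4 * k * (56 %/ 24) + 4 * k)%N = (12 * k)%N) // (_ : (56 %/ 24)%N = 2%N) //; lia.
Qed.

Lemma mxl_addl m n A B : shape m n A -> shape m n B -> mxl m n (addl A B) = mxl m n A + mxl m n B.
Proof.
move=> /shapeP[sA rA] /shapeP[sB rB]; apply/matrixP => i j; rewrite !mxE /addl.
rewrite (nth_map ([::], [::])) ?size_zip ?sA ?sB ?minnn // nth_zip ?sA ?sB //=.
rewrite (nth_map (0, 0)) ?size_zip ?rA ?rB ?minnn // nth_zip ?rA ?rB //=.
by rewrite (rmorphD int_of_Z).
Qed.

Definition list_frame (k : Z) (F1 F2 : seq (seq Z)) : bool :=
  [&& shape 56 28 F1, shape 56 28 F2,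
      addl (mulT F1 F1) (mulT F2 F2) == scall 56 (Z.mul 6 k) &
      dvdl 3 (addl F2 (negl (mull 28 F1 tern_M)))].

Lemma shape_mulT m p n A B : shape m n A -> size B = p -> shape m p (mulT A B).
Proof.
move=> /shapeP[sA _] sB; rewrite /shape size_map sA eqxx andTb.
by apply/allP => r /mapP[a _ ->]; rewrite size_map sB.
Qed.

Lemma shape_negl m n A : shape m n A -> shape m n (negl A).
Proof.
move=> /andP[sA /allP rA]; rewrite /shape size_map sA andTb.
by apply/allP => r /mapP[a /rA ra ->]; rewrite size_map.
Qed.

Lemma list_frameP k F1 F2 : list_frame k F1 F2 ->
  let F : 'M[int]_(28 + 28) := row_mx (mxl 56 28 F1) (mxl 56 28 F2) in
  F *m F^T = (6 * int_of_Z k)%:M /\ dvdmx 3 (rsubmx F - lsubmx F *m MM).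
Proof.
move=> /and4P[s1 s2 /eqP e d] F; have [z1 _] := shapeP s1; have [z2 _] := shapeP s2.
split.
  rewrite /F tr_row_mx mul_row_col (mxl_mulT s1 s1) (mxl_mulT s2 s2).
  by rewrite -mxl_addl ?(shape_mulT s1) ?(shape_mulT s2) // e mxl_scall (rmorphM int_of_Z).
rewrite /F row_mxKl row_mxKr -(mxl_mull s1 shape_tern_M) -mxl_negl -mxl_addl //.
  exact: (@dvdl_mx 3%coqZ).
by apply: shape_negl; apply: shape_mulT s1 _; rewrite size_map size_iota.
Qed.

(** * Integral quaternions acting on the left *)

Definition unitm (t : nat) : 'M[int]_28 := mxl 28 28 (unitl t).

Lemma shape_unitl t : shape 28 28 (unitl t).
Proof. exact: shape_monol. Qed.

Lemma unitm_comm t : (t < 4)%N -> unitm t *m MM = MM *m unitm t.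
Proof.
move=> t4; rewrite -(mxl_mull (shape_unitl t) shape_tern_M) tern_M_unit //.
by rewrite (mxl_mull shape_tern_M (shape_unitl t)).
Qed.

Lemma unitm_tr t : (0 < t < 4)%N -> (unitm t)^T = - unitm t.
Proof.
move=> t4; rewrite -(mxl_trl (shape_unitl t)) -mxl_negl; congr mxl.
by case: t t4 => [|[|[|[|//]]]] // _; vm_compute.
Qed.

Lemma unitm_sqr t : (0 < t < 4)%N -> unitm t *m unitm t = - 1%:M.
Proof.
move=> t4; rewrite -(mxl_mull (shape_unitl t) (shape_unitl t)).
rewrite (_ : mull _ _ _ = scall 28 (-1)%coqZ); first by rewrite mxl_scall -raddfN.
by case: t t4 => [|[|[|[|//]]]] // _; vm_compute.
Qed.

Lemma unitm_anticomm s t : (0 < s < t)%N -> (t < 4)%N -> unitm t *m unitm s = - (unitm s *m unitm t).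
Proof.
move=> st t4; rewrite -!(mxl_mull (shape_unitl _) (shape_unitl _)) -mxl_negl; congr mxl.
by case: t s st t4 => [|[|[|[|//]]]] [|[|[|[|//]]]] // _ _; vm_compute.
Qed.

Definition lipschitz (a b c d : int) : 'M[int]_28 :=
  a%:M + (b *: unitm 1 + c *: unitm 2 + d *: unitm 3).

Lemma lipschitz_comm a b c d : lipschitz a b c d *m MM = MM *m lipschitz a b c d.
Proof.
rewrite /lipschitz !mulmxDl !mulmxDr -!scalemxAl -!scalemxAr !unitm_comm //.
by rewrite mul_scalar_mx mul_mx_scalar.
Qed.

(** The imaginary part X is skew, and X^2 = -(b^2 + c^2 + d^2) because the units square to -1 and
    anticommute; so the product is (a + X)(a - X) = a^2 - X^2. *)
Lemma lipschitz_norm a b c d :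
  lipschitz a b c d *m (lipschitz a b c d)^T = (a ^+ 2 + b ^+ 2 + c ^+ 2 + d ^+ 2)%:M.
Proof.
rewrite /lipschitz; set X := b *: _ + _ + _.
have Xt : X^T = - X by rewrite /X !linearD !linearZ /= !unitm_tr // !scalerN -!opprD.
have XX : X *m X = (- (b ^+ 2 + c ^+ 2 + d ^+ 2))%:M.
  rewrite /X !mulmxDl !mulmxDr -!scalemxAl -!scalemxAr !unitm_sqr //.
  rewrite (@unitm_anticomm 1 2) // (@unitm_anticomm 1 3) // (@unitm_anticomm 2 3) //.
  move: (unitm 1 *m unitm 2) (unitm 1 *m unitm 3) (unitm 2 *m unitm 3) => A B C.
  by apply/matrixP => i j; rewrite !mxE; case: (i == j); rewrite ?mulr1n ?mulr0n; ring.
rewrite linearD /= tr_scalar_mx Xt mulmxDl !mulmxDr !mulmxN XX mul_scalar_mx mul_mx_scalar.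
rewrite scale_scalar_mx mul_scalar_mx.
move: X {Xt XX} => X.
by apply/matrixP => i j; rewrite !mxE; case: (i == j); rewrite ?mulr1n ?mulr0n; ring.
Qed.

Lemma lipschitz_normT a b c d :
  (lipschitz a b c d)^T *m lipschitz a b c d = (a ^+ 2 + b ^+ 2 + c ^+ 2 + d ^+ 2)%:M.
Proof.
have E : (lipschitz a b c d)^T = lipschitz a (- b) (- c) (- d).
  by rewrite /lipschitz !linearD /= tr_scalar_mx !linearZ /= !unitm_tr // !scaleNr !scalerN.
rewrite -{2}[lipschitz a b c d]trmxK E lipschitz_norm; congr (_%:M); ring.
Qed.

Lemma lipschitz_mod3 e z u v w :
  lipschitz (e + 3 * z) (3 * u) (3 * v) (3 * w) = e%:M + 3 *: lipschitz z u v w.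
Proof.
by rewrite /lipschitz raddfD /= -addrA -(scale_scalar_mx _ 3) !scalerDr !scalerA.
Qed.

Lemma tern_M_mulT : MM^T *m MM = 50%:M.
Proof. exact: scalar_mul_comm tern_M_mul. Qed.

(* For [e = 0] the frame consists of quaternion multiples of the standard basis. *)
Lemma lipschitz_extremal (k : nat) (e z u v w : int) : (2 < k)%N ->
  6 * k%:Z = (e + 3 * z) ^+ 2 + (3 * u) ^+ 2 + (3 * v) ^+ 2 + (3 * w) ^+ 2 + 50 * e ^+ 2 ->
  exists C : {set 'rV['Z_(2 * k)]_56}, extremal_typeII C.
Proof.
move=> k3 ek; pose L := lipschitz (e + 3 * z) (3 * u) (3 * v) (3 * w).
pose L' := lipschitz z u v w.
have eL : L = e%:M + 3 *: L' by apply: lipschitz_mod3.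
have LM : L *m MM = MM *m L by apply: lipschitz_comm.
have LMt : MM^T *m L^T = L^T *m MM^T by rewrite -!trmx_mul LM.
apply: (@frame_extremal k (block_mx L (e *: MM) (- (e *: MM^T)) L^T) k3).
  rewrite tr_block_mx trmxK (_ : (- (e *: MM^T))^T = - (e *: MM)); last first.
    by rewrite linearN linearZ /= trmxK.
  rewrite (_ : (e *: MM)^T = e *: MM^T); last by rewrite linearZ.
  have e11 : L *m L^T + (e *: MM) *m (e *: MM^T) = (6 * k%:Z)%:M.
    rewrite lipschitz_norm -scalemxAl -scalemxAr tern_M_mul !scale_scalar_mx -raddfD.
    by congr (_%:M); rewrite ek; ring.
  have e12 : L *m (- (e *: MM)) + (e *: MM) *m L = 0.
    by rewrite mulmxN -scalemxAr -scalemxAl LM addNr.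
  have e21 : - (e *: MM^T) *m L^T + L^T *m (e *: MM^T) = 0.
    by rewrite mulNmx -scalemxAr -scalemxAl LMt addNr.
  have e22 : - (e *: MM^T) *m (- (e *: MM)) + L^T *m L = (6 * k%:Z)%:M.
    rewrite mulNmx mulmxN opprK lipschitz_normT -scalemxAl -scalemxAr tern_M_mulT.
    by rewrite !scale_scalar_mx -raddfD; congr (_%:M); rewrite ek; ring.
  by rewrite mulmx_block e11 e12 e21 e22 [RHS]scalar_mx_block.
rewrite block_mxEh row_mxKl row_mxKr mul_col_mx opp_col_mx add_col_mx.
(* Since L = e mod 3, the first defect is a multiple of 3; in the second, e + 50 e = 3 * 17 e. *)
have -> : e *: MM - L *m MM = 3 *: (- (L' *m MM)).
  by rewrite eL mulmxDl mul_scalar_mx opprD addNKr -scalemxAl scalerN.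
have -> : L^T - - (e *: MM^T) *m MM = 3 *: ((17 * e)%:M + L'^T).
  rewrite eL mulNmx opprK -scalemxAl tern_M_mulT linearD linearZ /= tr_scalar_mx.
  rewrite addrAC scale_scalar_mx -raddfD scalerDr scale_scalar_mx /=.
  by congr (_%:M + _); ring.
apply/dvdmxP; exists (col_mx (- (L' *m MM)) ((17 * e)%:M + L'^T)).
by rewrite scale_col_mx.
Qed.

(* The frames for k = 4, 5, 7 were found by computer search among block matrices of quaternionic
   circulants. *)
Definition frame4 : seq (seq Z) * seq (seq Z) :=
  let x := palindrome (1, 0, 0, 0) (-1, 0, 1, 0) (0, -1, 0, 0) (0, 0, 0, -1) in
  let y := palindrome (0, -1, 1, 1) (0, 0, -1, -1) (0, 1, 0, 0) (0, 1, 1, 1) in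
  let u := palindrome (1, 1, 1, 0) (-1, 0, 1, 0) (0, -1, 0, 0) (-1, 1, -1, 0) in
  let v := palindrome (0, 0, 0, -1) (0, 0, 1, 1) (0, -1, 0, 0) (-1, 0, 0, 0) in
  (quat_circulant x ++ quat_circulant u, quat_circulant y ++ quat_circulant v)%coqZ.

(** The block shape of the frames (L, M; -M^T, L^T), with a group ring element P in place of L. When
    [p] has real coefficients, P is central in the group ring, which makes the two block rows
    orthogonal. *)
Definition symmetric_frame (p y : seq quat) : seq (seq Z) * seq (seq Z) :=
  let P := quat_circulant p in let Y := quat_circulant y in
  (P ++ negl (trl 28 Y), Y ++ trl 28 P).

Definition frame5 := (symmetric_frame
  (palindrome (0, 0, 0, 0) (1, 0, 0, 0) (0, 0, 0, 0) (1, 0, 0, 0))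
  (palindrome (0, 1, -1, 0) (1, 0, 1, -1) (1, 0, 0, 1) (-2, -1, 1, -1)))%coqZ.

Definition frame7 := (symmetric_frame
  (palindrome (0, 0, 0, 0) (0, 0, 0, 0) (1, 0, 0, 0) (0, 0, 0, 0))
  (palindrome (-2, -1, -1, -2) (0, -1, 1, 0) (0, 1, -1, 1) (1, -2, 2, 1)))%coqZ.

Lemma list_frame_extremal (k : Z) (F : seq (seq Z) * seq (seq Z)) :
  list_frame k F.1 F.2 -> (2 < Z.to_nat k)%N ->
  exists C : {set 'rV['Z_(2 * Z.to_nat k)]_56}, extremal_typeII C.
Proof.
move=> /list_frameP[FF D] k3; apply: (frame_extremal k3 _ D).
have -> : (Z.to_nat k)%:Z = int_of_Z k by clear -k3; lia.
exact: FF.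
Qed.

(* A quaternion of norm 2 doubles the norm of the frame for k = 4. *)
Lemma extremal_code8 : exists C : {set 'rV['Z_(2 * 8)]_56}, extremal_typeII C.
Proof.
have [FF /dvdmxP[D eD]] := @list_frameP 4%coqZ frame4.1 frame4.2 isT.
move: (row_mx _ _) FF eD => F FF eD.
pose L := lipschitz 1 1 0 0; pose Q : 'M[int]_(28 + 28) := block_mx L 0 0 L.
have QQ : Q *m Q^T = 2%:M.
  rewrite tr_block_mx !trmx0 mulmx_block !mulmx0 !mul0mx !addr0 !add0r lipschitz_norm.
  by rewrite [RHS]scalar_mx_block.
apply: (@frame_extremal 8 (Q *m F) isT).
  rewrite trmx_mul mulmxA -[Q *m F *m _]mulmxA FF mul_mx_scalar -scalemxAl QQ scale_scalar_mx.
  by congr (_%:M).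
apply/dvdmxP; exists (Q *m D); rewrite scalemxAr -eD mulmxBr mulmxA.
by rewrite -[F in LHS]hsubmxK mul_mx_row row_mxKl row_mxKr.
Qed.

Close Scope ring_scope.

Theorem theorem6p6 (k : nat) (hk : (0 < k)%N) :
  exists C : {set 'rV['Z_(2 * k)]_56}, extremal_typeII C.
Proof.
have [k9|k8] := ltnP 8 k.
  (* The norm that L must have when e = 1. *)
  have k6 : (6 * k - 50) %% 6 = 4 by lia.
  have [z [u [v [w e]]]] := sum4_mod3 k6.
  apply: (@lipschitz_extremal k 1%R z u v w); first exact: leq_trans k9.
  by rewrite expr1n mulr1 -e; lia.
move: hk k8; case: k => [|[|[|[|[|[|[|[|[|//]]]]]]]]] // _ _.
- exact: extremal_code1.
- exact: extremal_code2.
(* With e = 0 the norm 6k must be 9 times a sum of four squares; 18 = 9 * 2 and, for k = 6, 36 = 9 *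
   4. *)
- exact: (@lipschitz_extremal 3 0 1 1 0 0)%R.
- exact: (@list_frame_extremal 4%coqZ frame4 isT isT).
- exact: (@list_frame_extremal 5%coqZ frame5 isT isT).
- exact: (@lipschitz_extremal 6 0 1 1 1 1)%R.
- exact: (@list_frame_extremal 7%coqZ frame7 isT isT).
- exact: extremal_code8.
Qed.
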